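(* Let $K$ be a field and let $R$ be a standard graded commutative $K$-algebra. Then: (1) the Veronese subalgebra $R^{(c)}$ is Koszul for all sufficiently large integers $c$; (2) if $R=S/I$ with $S=K[x_1,\dots,x_n]$ a polynomial ring with its standard grading and $I\subset S$ a homogeneous ideal, then $R^{(c)}$ is Koszul for every positive integer $c$ such that $$c\ge \max\left\{\frac{t_i^S(R)}{1+i} : i\ge 0\right\}.$$
   Context: A standard graded $K$-algebra is a commutative $K$-algebra $R=\bigoplus_{i\in\mathbb N}R_i$ with $R_0=K$, $\dim_K R_1<\infty$ and $R_iR_j=R_{i+j}$ for all $i,j\in\mathbb N$ (where $0\in\mathbb N$). The field $K=R/\bigoplus_{i>0}R_i$ is regarded as a graded $R$-module. For a standard graded $K$-algebra $A$ and a finitely generated graded $A$-module $M$, put $\beta^A_{ij}(M)=\dim_K\operatorname{Tor}_i^A(M,K)_j$ and $t_i^A(M)=\sup\{j:\beta_{ij}^A(M)\ne 0\}$, with $t_i^A(M)=-\infty$ if $\operatorname{Tor}_i^A(M,K)=0$. The algebra $A$ is Koszul if $\beta^A_{ij}(K)=0$ whenever $i\ne j$. The $c$-th Veronese subalgebra of $R$ is $R^{(c)}=\bigoplus_{j\in\mathbb Z}R_{jc}$, regarded as a standard graded $K$-algebra whose degree $j$ component is $R_{jc}$. *)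

(* Defs.v *)
From HB Require Import structures.
From mathcomp Require Import all_boot all_order all_algebra.
From mathcomp Require Import boolp classical_sets reals constructive_ereal ereal Rstruct.
From mathcomp Require Import -(notations) mpoly.

Set Implicit Arguments.
Unset Strict Implicit.
Unset Printing Implicit Defensive.

Import Order.TTheory GRing.Theory Num.Theory.
Local Open Scope ring_scope.

(* V is the internal direct sum of the additive subgroups gr i *)
Record is_grading (I : eqType) (V : zmodType) (gr : I -> V -> Prop) : Prop := {
  grading0 : forall i, gr i 0;
  gradingB : forall i x y, gr i x -> gr i y -> gr i (x - y);
  grading_gen : forall x, exists (s : I -> V) (r : seq I),
    [/\ uniq r, forall i, gr i (s i) & x = \sum_(i <- r) s i];
  grading_free : forall (s : I -> V) (r : seq I),
    uniq r -> (forall i, gr i (s i)) -> \sum_(i <- r) s i = 0 ->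
    forall i, i \in r -> s i = 0 }.

Section Components.
Variables (I : eqType) (V : zmodType) (gr : I -> V -> Prop).
Hypothesis G : is_grading gr.

Lemma comp_subproof x : exists p : (I -> V) * seq I,
  [/\ uniq p.2, forall i, gr i (p.1 i) & x = \sum_(i <- p.2) p.1 i].
Proof. by have [s [r h]] := grading_gen G x; exists (s, r). Qed.

Definition hsupp x : seq I := (sval (cid (comp_subproof x))).2.

(* the homogeneous component of x of degree i *)
Definition hcomp (i : I) (x : V) : V :=
  if i \in hsupp x then (sval (cid (comp_subproof x))).1 i else 0.

Lemma hsupp_uniq x : uniq (hsupp x).
Proof. by rewrite /hsupp; case: cid => p []. Qed.

Lemma comp_gr i x : gr i (hcomp i x).
Proof.
rewrite /hcomp; case: ifP => _; last exact: grading0 G i.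
by case: cid => p [].
Qed.

Lemma compE x : x = \sum_(i <- hsupp x) hcomp i x.
Proof.
transitivity (\sum_(i <- hsupp x) (sval (cid (comp_subproof x))).1 i).
  by rewrite /hsupp; case: cid => p [].
by apply: eq_big_seq => i ix; rewrite /hcomp ix.
Qed.

Lemma comp_out i x : i \notin hsupp x -> hcomp i x = 0.
Proof. by rewrite /hcomp => /negPf ->. Qed.

Lemma sum_widen (s : I -> V) (r r' : seq I) : uniq r -> uniq r' ->
  {subset r <= r'} -> (forall i, i \notin r -> s i = 0) ->
  \sum_(i <- r) s i = \sum_(i <- r') s i.
Proof.
move=> ur ur' rr' s0.
rewrite (perm_big [seq i <- r' | i \in r]); last first.
  apply: uniq_perm => //; first exact: filter_uniq.
  by move=> i; rewrite mem_filter /=; case ir: (i \in r) => //; rewrite rr'.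
rewrite big_filter big_mkcond /=; apply: eq_bigr => i _.
by case: ifPn => // /s0.
Qed.

Lemma comp_uniq x (s : I -> V) r : uniq r -> (forall i, gr i (s i)) ->
  (forall i, i \notin r -> s i = 0) -> x = \sum_(i <- r) s i ->
  forall i, hcomp i x = s i.
Proof.
move=> ur gs s0 xE i.
pose r' := undup (r ++ hsupp x).
have ur' : uniq r' by exact: undup_uniq.
have sr : {subset r <= r'} by move=> j jr; rewrite mem_undup mem_cat jr.
have sx : {subset hsupp x <= r'}.
  by move=> j jr; rewrite mem_undup mem_cat jr orbT.
have [ir'|] := boolP (i \in r'); last first.
  rewrite mem_undup mem_cat negb_or => /andP[ir ix].
  by rewrite comp_out // s0.
apply/eqP; rewrite -subr_eq0; apply/eqP.
apply: (@grading_free _ _ _ G (fun j => hcomp j x - s j) r') => //.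
  by move=> j; apply: gradingB => //; exact: comp_gr.
rewrite sumrB -(sum_widen ur ur' sr s0).
rewrite -(sum_widen (hsupp_uniq x) ur' sx (fun i => @comp_out i x)).
by rewrite -compE -xE subrr.
Qed.

Lemma comp_homog i j x : gr i x -> hcomp j x = if j == i then x else 0.
Proof.
move=> gx; apply: (@comp_uniq _ (fun k => if k == i then x else 0) [:: i]) => //.
- by move=> k; case: eqP => [->|_] //; exact: grading0.
- by move=> k; rewrite inE => /negPf ->.
- by rewrite big_seq1 eqxx.
Qed.

Lemma compB i x y : hcomp i (x - y) = hcomp i x - hcomp i y.
Proof.
pose r := undup (hsupp x ++ hsupp y).
have ur : uniq r by exact: undup_uniq.
apply: (@comp_uniq _ (fun j => hcomp j x - hcomp j y) r) => //.
- by move=> j; apply: gradingB => //; exact: comp_gr.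
- move=> j; rewrite mem_undup mem_cat negb_or => /andP[jx jy].
  by rewrite !comp_out // subrr.
- have sE z : {subset hsupp z <= r} -> z = \sum_(j <- r) hcomp j z.
    move=> h; rewrite {1}[z]compE.
    by apply: sum_widen => //; [exact: hsupp_uniq | by move=> j /comp_out].
  by rewrite sumrB -!sE // => j jr; rewrite mem_undup mem_cat jr ?orbT.
Qed.

Lemma comp0 i : hcomp i 0 = 0.
Proof. by rewrite -[X in hcomp i X](subrr 0) compB subrr. Qed.

Lemma compD i x y : hcomp i (x + y) = hcomp i x + hcomp i y.
Proof. by rewrite -{1}[y]opprK -{1}[- y]sub0r !compB comp0 sub0r opprK. Qed.

Lemma comp_sum i (J : Type) (l : seq J) (F : J -> V) :
  hcomp i (\sum_(j <- l) F j) = \sum_(j <- l) hcomp i (F j).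
Proof. by apply: big_morph => [x y|]; rewrite ?compD ?comp0. Qed.

Lemma gradingD i x y : gr i x -> gr i y -> gr i (x + y).
Proof.
move=> gx gy; rewrite -[y]opprK -[- y]sub0r.
by do 2 apply: gradingB => //; exact: grading0.
Qed.

Lemma grading_sum i (J : eqType) (l : seq J) (F : J -> V) :
  (forall j, j \in l -> gr i (F j)) -> gr i (\sum_(j <- l) F j).
Proof.
move=> h; rewrite big_seq; apply: big_ind => [|x y|j jl]; last exact: h.
  exact: grading0.
exact: gradingD.
Qed.

End Components.

(* A standard graded K-algebra: A = (+)_(i in nat) A_i with A_0 = K,
   dim_K A_1 finite and A_i A_j = A_(i+j). *)
Record stdGradedAlg (K : fieldType) := StdGradedAlg {
  gcarrier :> comAlgType K;
  gr : nat -> gcarrier -> Prop;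
  gr_grading : is_grading gr;
  gr0P : forall x, gr 0 x <-> exists k : K, x = k%:A;
  grM : forall i j x y, gr i x -> gr j y -> gr (i + j) (x * y);
  grM_gen : forall i j z, gr (i + j) z ->
    exists2 s : seq (gcarrier * gcarrier),
      (forall p, p \in s -> gr i p.1 /\ gr j p.2) & z = \sum_(p <- s) p.1 * p.2;
  gr1_fin : exists2 g : seq gcarrier, (forall x, x \in g -> gr 1 x) &
    forall x, gr 1 x ->
      exists a : gcarrier -> K, x = \sum_(y <- g) a y *: y }.

(* the grading extended by zero to negative degrees *)
Definition grz (K : fieldType) (A : stdGradedAlg K) (d : int) (x : A) : Prop :=
  match d with Posz i => gr i x | Negz _ => x = 0 end.

Section Augmentation.
Variables (K : fieldType) (A : stdGradedAlg K).

Definition gcomp : nat -> A -> A := hcomp (gr_grading A).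

Lemma grZ i (k : K) (x : A) : gr i x -> gr i (k *: x).
Proof.
move=> gx; rewrite -[x]mul1r scalerAl -[i]add0n.
by apply: grM => //; apply/gr0P; exists k.
Qed.

Lemma grA (k : K) : gr 0 (k%:A : A).
Proof. by apply/gr0P; exists k. Qed.

Lemma gr1 : gr 0 (1 : A).
Proof. by rewrite -[1]scale1r; exact: grA. Qed.

Lemma gcompZ i (k : K) (x : A) : gcomp i (k *: x) = k *: gcomp i x.
Proof.
rewrite /gcomp {1}[x](compE (gr_grading A)) scaler_sumr comp_sum.
rewrite [in RHS](compE (gr_grading A) x) comp_sum scaler_sumr.
apply: eq_bigr => j _; have gj := comp_gr (gr_grading A) j x.
rewrite (comp_homog (gr_grading A) i gj).
rewrite (comp_homog (gr_grading A) i (grZ k gj)).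
by case: ifP; rewrite ?scaler0.
Qed.

Lemma gcompM i (x y : A) : gcomp i (x * y) =
  \sum_(a <- hsupp (gr_grading A) x) \sum_(b <- hsupp (gr_grading A) y)
    if i == (a + b)%N then gcomp a x * gcomp b y else 0.
Proof.
rewrite /gcomp {1}[x](compE (gr_grading A)) {1}[y](compE (gr_grading A)).
rewrite mulr_suml comp_sum; apply: eq_bigr => a _.
rewrite mulr_sumr comp_sum; apply: eq_bigr => b _.
by apply: comp_homog; apply: grM; exact: comp_gr.
Qed.

Lemma gcomp0E (x : A) : gcomp 0 x =
  \sum_(a <- hsupp (gr_grading A) x) if a == 0%N then gcomp a x else 0.
Proof.
rewrite {1}/gcomp {1}[x](compE (gr_grading A)) comp_sum.
apply: eq_bigr => a _.
by rewrite (comp_homog _ _ (comp_gr (gr_grading A) a x)) eq_sym.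
Qed.

Lemma gcomp0M (x y : A) : gcomp 0 (x * y) = gcomp 0 x * gcomp 0 y.
Proof.
rewrite gcompM (gcomp0E x) (gcomp0E y) mulr_suml; apply: eq_bigr => a _.
rewrite mulr_sumr; apply: eq_bigr => b _.
by case: a => [|a]; case: b => [|b]; rewrite ?mulr0 ?mul0r.
Qed.

Lemma aug_subproof (x : A) : exists k : K, gcomp 0 x = k%:A.
Proof. by apply/gr0P; exact: comp_gr. Qed.

(* the quotient map A -> A / (+)_(i > 0) A_i = K *)
Definition aug (x : A) : K := sval (cid (aug_subproof x)).

Lemma augE x : (aug x)%:A = gcomp 0 x.
Proof. by rewrite /aug; case: cid. Qed.

Lemma scale1_inj : injective (fun k : K => k%:A : A).
Proof.
move=> k l /eqP; rewrite -subr_eq0 -scalerBl scaler_eq0 oner_eq0 orbF.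
by rewrite subr_eq0 => /eqP.
Qed.

Lemma aug_is_additive : additive aug.
Proof.
by move=> x y; apply: scale1_inj; rewrite augE scalerBl !augE /gcomp compB.
Qed.

Lemma aug_is_multiplicative : multiplicative aug.
Proof.
split=> [x y|]; apply: scale1_inj.
  by rewrite augE -scalerA -mulr_algl !augE gcomp0M.
by rewrite augE scale1r /gcomp (comp_homog _ _ gr1).
Qed.

HB.instance Definition _ := GRing.isAdditive.Build A K aug aug_is_additive.
HB.instance Definition _ :=
  GRing.isMultiplicative.Build A K aug aug_is_multiplicative.

Lemma grz_grading : is_grading (grz (A := A)).
Proof.
pose G := gr_grading A; split.
- by case=> i //=; exact: grading0.
- case=> i x y //= => [|-> ->]; last by rewrite subrr.
  exact: gradingB.
- move=> x; exists (fun d => if d is Posz i then gcomp i x else 0).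
  exists (map Posz (hsupp G x)); split.
  + by rewrite map_inj_uniq ?hsupp_uniq // => i j [].
  + by case=> i //=; exact: comp_gr.
  + by rewrite big_map /=; exact: compE.
- move=> s r ur hs s0.
  pose f (d : int) := if d is Posz i then Some i else None.
  have fP : ocancel f Posz by case.
  have sum0 : \sum_(i <- pmap f r) s (Posz i) = 0.
    rewrite -[RHS]s0 big_pmap; apply: eq_bigr => -[i|i] _ //=.
    by rewrite (hs (Negz i)).
  case=> i ir; last exact: (hs (Negz i)).
  apply: (@grading_free _ _ _ G (fun i => s (Posz i)) (pmap f r)) => //.
  + exact: pmap_uniq fP _ ur.
  + by move=> j; exact: (hs (Posz j)).
  + by rewrite mem_pmap; apply/mapP; exists (Posz i).
Qed.

End Augmentation.

Section PolynomialAlgebra.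
Variables (K : fieldType) (n : nat).
Local Notation S := (mpoly n K).

Definition mpoly_gr (d : nat) (p : S) : Prop := p \is ishomog1 d mdeg.

Lemma mpoly_gr_grading : is_grading mpoly_gr.
Proof.
split.
- by move=> i; exact: rpred0.
- by move=> i x y gx gy; exact: rpredB.
- move=> p; exists (fun d => pihomog mdeg d p), (iota 0 (mmeasure mdeg p)).
  split; [exact: iota_uniq | by move=> d; exact: pihomogP |].
  rewrite {1}(pihomog_partitionE (leqnn (mmeasure mdeg p))).
  by rewrite -(big_mkord predT (fun d => pihomog mdeg d p)) /index_iota subn0.
- move=> s r ur hs s0 i ir.
  have : pihomog mdeg i (\sum_(d <- r) s d) = 0 by rewrite s0 raddf0.
  rewrite raddf_sum (bigD1_seq i) //= big1 ?addr0.
    by rewrite pihomog_dE; [move=> -> | exact: hs].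
  by move=> j ji; apply: pihomog_ne0 (hs j).
Qed.

Lemma mpoly_gr0P (x : S) : mpoly_gr 0 x <-> exists k : K, x = k%:A.
Proof.
split=> [hx|[k ->]]; last by apply: rpredZ; exact: dhomog1.
exists (mcoeff mnm0 x); rewrite -mul_mpolyC mulr1; apply/mpolyP => m.
rewrite mcoeffC; case: eqP => [<-|m0]; rewrite ?mulr1 ?mulr0 //.
by rewrite (dhomog_nemf_coeff hx) //= mdeg_eq0; apply/eqP.
Qed.

Lemma mnm_split i j (m : multinom n) : mdeg m = (i + j)%N ->
  exists m1 m2, [/\ mdeg m1 = i, mdeg m2 = j & m = mnm_add m1 m2].
Proof.
elim: i j => [|i IH] j mE; first by exists mnm0, m; rewrite mdeg0 add0m.
have [m1 [m2 [m1E m2E mS]]] := IH j.+1 (etrans mE (addSnnS i j)).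
have [k k0] : exists k, m2 k != 0%N.
  apply/existsP; apply: contra_eqT m2E; rewrite negb_exists => /forallP h.
  by rewrite mdegE big1 // => k _; apply/eqP; rewrite -[_ == _]negbK.
have kle : lem (mnm1 k) m2 by rewrite lep1mP.
exists (mnm_add m1 (mnm1 k)), (mnm_sub m2 (mnm1 k)); split.
- by rewrite mdegD mdeg1 m1E addn1.
- by apply/eqP; rewrite -(eqn_add2r 1) -{1}(mdeg1 k) -mdegD submK // m2E addn1.
- by rewrite -addmA [mnm_add (mnm1 k) _]addmC submK.
Qed.

Lemma mpoly_grM_gen i j (z : S) : mpoly_gr (i + j) z ->
  exists2 s : seq (S * S),
    (forall p, p \in s -> mpoly_gr i p.1 /\ mpoly_gr j p.2) &
    z = \sum_(p <- s) p.1 * p.2.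
Proof.
move=> hz; rewrite [z]mpolyE.
have : forall m, m \in msupp z -> mdeg m = (i + j)%N by exact: dhomog_mf hz.
elim: (msupp z : seq _) => [|m l IH] hl.
  by exists [::]; rewrite ?big_nil.
have [s hs sE] : exists2 s : seq (S * S),
    (forall p, p \in s -> mpoly_gr i p.1 /\ mpoly_gr j p.2) &
    \sum_(m <- l) mcoeff m z *: mpolyX K m = \sum_(p <- s) p.1 * p.2.
  by apply: IH => m' m'l; apply: hl; rewrite inE m'l orbT.
have [m1 [m2 [m1E m2E mE]]] := mnm_split (hl m (mem_head _ _)).
exists ((mcoeff m z *: mpolyX K m1, mpolyX K m2) :: s).
  move=> p; rewrite inE => /predU1P[->|]; last exact: hs.
  split; rewrite /mpoly_gr /=; last by rewrite dhomogX /= m2E.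
  by apply: rpredZ; rewrite dhomogX /= m1E.
by rewrite !big_cons /= sE -scalerAl -mpolyXD -mE.
Qed.

Lemma mpoly_gr1_fin : exists2 g : seq S, (forall x, x \in g -> mpoly_gr 1 x) &
  forall x, mpoly_gr 1 x ->
    exists a : S -> K, x = \sum_(y <- g) a y *: y.
Proof.
exists [seq mpolyX K (mnm1 i) | i <- enum 'I_n] => [x|x hx].
  by case/mapP=> i _ ->; rewrite /mpoly_gr dhomogX /= mdeg1.
exists (fun y => mcoeff (mlead y) x); rewrite big_map big_enum /=.
apply/mpolyP => m; rewrite raddf_sum /=.
have [/mdeg1P[k /eqP ->]|m1] := boolP (mdeg m == 1%N); last first.
  rewrite (dhomog_nemf_coeff hx m1) big1 // => i _.
  rewrite mcoeffZ mcoeffX; case: eqP => [E|]; rewrite ?mulr0 //.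
  by rewrite -E mdeg1 in m1.
rewrite (bigD1 k) //= mcoeffZ mcoeffX eqxx mulr1 mleadXm big1 ?addr0 // => i ik.
by rewrite mcoeffZ mcoeffX eq_mnm1 (negPf ik) mulr0.
Qed.

Definition polyAlg : stdGradedAlg K :=
  StdGradedAlg mpoly_gr_grading mpoly_gr0P
    (fun i j x y hx hy => dhomogM hx hy) mpoly_grM_gen mpoly_gr1_fin.

End PolynomialAlgebra.

Lemma gr_fin (K : fieldType) (R : stdGradedAlg K) i :
  exists2 g : seq R, (forall x, x \in g -> gr i x) &
  forall x, gr i x -> exists a : R -> K, x = \sum_(y <- g) a y *: y.
Proof.
elim: i => [|i [g hg gP]].
  exists [:: 1] => [x|x /gr0P[k ->]]; first by rewrite inE => /eqP ->; exact: gr1.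
  by exists (fun=> k); rewrite big_seq1.
have [h hh hP] := gr1_fin R.
pose l := undup [seq y * z | y <- g, z <- h].
have lD (J : Type) (r : seq J) (F : J -> R) :
    (forall j, exists a : R -> K, F j = \sum_(y <- l) a y *: y) ->
    exists a : R -> K, \sum_(j <- r) F j = \sum_(y <- l) a y *: y.
  move=> FP; elim: r => [|j r [a aE]].
    by exists (fun=> 0); rewrite big_nil big1 // => y _; rewrite scale0r.
  have [b bE] := FP j; exists (fun y => b y + a y).
  by rewrite big_cons bE aE -big_split; apply: eq_bigr => y _; rewrite scalerDl.
have lZ k x : (exists a : R -> K, x = \sum_(y <- l) a y *: y) ->
    exists a : R -> K, k *: x = \sum_(y <- l) a y *: y.
  move=> [a ->]; exists (fun y => k * a y).
  by rewrite scaler_sumr; apply: eq_bigr => y _; rewrite scalerA.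
have l1 x : x \in l -> exists a : R -> K, x = \sum_(y <- l) a y *: y.
  move=> xl; exists (fun y => (y == x)%:R).
  rewrite (bigD1_seq x) ?undup_uniq //= eqxx scale1r big1 ?addr0 // => y yx.
  by rewrite (negPf yx) scale0r.
exists l => [x|x].
  rewrite mem_undup => /allpairsP[[y z] [/= yg zh ->]]; rewrite -addn1.
  by apply: grM; [exact: hg | exact: hh].
rewrite -addn1 => /grM_gen[s hs ->]; rewrite big_seq big_mkcond /=.
apply: (lD _ _ _) => p; case: ifP => [ps|_]; last first.
  by exists (fun=> 0); rewrite big1 // => y _; rewrite scale0r.
have [/gP[a ->] /hP[b ->]] := hs p ps.
rewrite mulr_suml big_seq big_mkcond; apply: (lD _ _ _) => y.
case: ifP => [yg|_]; last first.
  by exists (fun=> 0); rewrite big1 // => z _; rewrite scale0r.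
rewrite mulr_sumr big_seq big_mkcond; apply: (lD _ _ _) => z.
case: ifP => [zh|_]; last first.
  by exists (fun=> 0); rewrite big1 // => w _; rewrite scale0r.
rewrite -scalerAl -scalerAr; do 2 apply: (lZ _ _); apply: l1.
by rewrite mem_undup allpairs_f.
Qed.

Section VeroneseSubalgebra.
Variables (K : fieldType) (R : stdGradedAlg K) (c : nat).

(* the elements of R all of whose components have degree divisible by c, i.e.
   the subspace (+)_j R_(j c) *)
Definition veronese_pred : {pred R} :=
  fun x => `[< forall i, ~~ (c %| i)%N -> gcomp i x = 0 >].

Lemma veronese_subalg : GRing.subalg_closed veronese_pred.
Proof.
split=> [|a x y /asboolP hx /asboolP hy|x y /asboolP hx /asboolP hy];
  apply/asboolP => i ci.
- rewrite /gcomp (comp_homog (gr_grading R) i (gr1 R)).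
  by case: eqP ci => // ->; rewrite dvdn0.
- by rewrite /gcomp compD -!/(gcomp _ _) gcompZ hx // hy // scaler0 addr0.
- rewrite gcompM big1 // => a _; rewrite big1 // => b _.
  case: eqP => // iE; have [ca|/hx ->] := boolP (c %| a)%N; last by rewrite mul0r.
  by rewrite hy ?mulr0 //; apply: contra ci => cb; rewrite iE dvdn_add.
Qed.

HB.instance Definition _ :=
  GRing.isSubalgClosed.Build K R veronese_pred veronese_subalg.

Record veronese_type := Veronese {
  veronese_val :> R; _ : veronese_val \in veronese_pred }.

HB.instance Definition _ := [isSub for veronese_val].
HB.instance Definition _ := [Choice of veronese_type by <:].
HB.instance Definition _ := [SubChoice_isSubAlgebra of veronese_type by <:].
HB.instance Definition _ := [SubNzRing_isSubComNzRing of veronese_type by <:].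

(* the degree j component of R^(c) is R_(j c) *)
Definition veronese_gr (j : nat) (x : veronese_type) : Prop :=
  gr (j * c) (val x).

Lemma gr_veronese j x : gr (j * c) x -> x \in veronese_pred.
Proof.
move=> gx; apply/asboolP => i ci; rewrite /gcomp (comp_homog _ _ gx).
by case: eqP ci => // ->; rewrite dvdn_mull.
Qed.

Hypothesis c_gt0 : (0 < c)%N.

Lemma veronese_gr_grading : is_grading veronese_gr.
Proof.
pose G := gr_grading R; split.
- by move=> j; rewrite /veronese_gr raddf0; exact: grading0.
- by move=> j x y gx gy; rewrite /veronese_gr raddfB; exact: gradingB.
- move=> x.
  have gv j : gcomp (j * c) (val x) \in veronese_pred.
    by apply: gr_veronese; exact: comp_gr.
  exists (fun j => Veronese (gv j)).
  exists [seq (i %/ c)%N | i <- hsupp G (val x) & (c %| i)%N]; split.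
  + rewrite map_inj_in_uniq ?filter_uniq ?hsupp_uniq // => i j.
    rewrite !mem_filter => /andP[ci _] /andP[cj _] E.
    by rewrite -(divnK ci) E divnK.
  + by move=> j; exact: comp_gr.
  + apply: val_inj; rewrite raddf_sum /= big_map big_filter big_mkcond /=.
    rewrite {1}[veronese_val x](compE G); apply: eq_bigr => i _.
    case: ifP => [ci|/negbT ci]; first by rewrite divnK.
    by move: (valP x) => /asboolP /(_ _ ci).
- move=> s r ur hs s0 j jr; apply: val_inj; rewrite raddf0.
  pose t i := if (c %| i)%N then val (s (i %/ c)%N) else 0.
  have tE k : t (k * c)%N = val (s k) by rewrite /t dvdn_mull // mulnK.
  rewrite -tE; apply: (@grading_free _ _ _ G t [seq (k * c)%N | k <- r]).
  + rewrite map_inj_uniq // => a b /eqP.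
    by rewrite eqn_pmul2r // => /eqP.
  + move=> i; rewrite /t; case: ifP => [ci|_]; last exact: grading0.
    by have := hs (i %/ c)%N; rewrite /veronese_gr divnK.
  + rewrite big_map -[RHS](raddf0 (val : veronese_type -> R)) -s0 raddf_sum.
    by apply: eq_bigr => k _; rewrite tE.
  + by apply/mapP; exists j.
Qed.

Lemma veronese_gr0P x : veronese_gr 0 x <-> exists k : K, x = k%:A.
Proof.
rewrite /veronese_gr mul0n gr0P; split=> -[k E]; exists k; first exact: val_inj.
by rewrite E.
Qed.

Lemma veronese_grM i j x y :
  veronese_gr i x -> veronese_gr j y -> veronese_gr (i + j) (x * y).
Proof. by move=> hx hy; rewrite /veronese_gr mulnDl; exact: grM. Qed.

Lemma veronese_grM_gen i j z : veronese_gr (i + j) z ->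
  exists2 s : seq (veronese_type * veronese_type),
    (forall p, p \in s -> veronese_gr i p.1 /\ veronese_gr j p.2) &
    z = \sum_(p <- s) p.1 * p.2.
Proof.
rewrite /veronese_gr mulnDl => /grM_gen[s hs zE].
have [s' hs' sE] : exists2 s' : seq (veronese_type * veronese_type),
    (forall p, p \in s' -> veronese_gr i p.1 /\ veronese_gr j p.2) &
    \sum_(p <- s) p.1 * p.2 = \sum_(p <- s') val p.1 * val p.2.
  elim: s hs {zE} => [|p s IH] hs; first by exists [::]; rewrite ?big_nil.
  have [|s' hs' sE] := IH; first by move=> q qs; apply: hs; rewrite inE qs orbT.
  have [g1 g2] := hs p (mem_head _ _).
  exists ((Veronese (gr_veronese g1), Veronese (gr_veronese g2)) :: s').
    by move=> q; rewrite inE => /predU1P[->|] //; exact: hs'.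
  by rewrite !big_cons sE.
exists s' => //; apply: val_inj; rewrite zE sE raddf_sum.
by apply: eq_bigr => p _.
Qed.

Lemma veronese_gr1_fin : exists2 g : seq veronese_type,
  (forall x, x \in g -> veronese_gr 1 x) &
  forall x, veronese_gr 1 x ->
    exists a : veronese_type -> K, x = \sum_(y <- g) a y *: y.
Proof.
have [g hg gP] := gr_fin R c.
exists (pmap insub g).
  move=> x; rewrite mem_pmap_sub => /hg gx.
  by rewrite /veronese_gr mul1n.
move=> x; rewrite /veronese_gr mul1n => /gP[a xE].
exists (fun y => a (val y)); apply: val_inj; rewrite xE raddf_sum big_pmap /=.
apply: eq_big_seq => y /hg gy.
have yv : y \in veronese_pred by apply: (@gr_veronese 1); rewrite mul1n.
by rewrite insubT.
Qed.

Definition veronese : stdGradedAlg K :=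
  StdGradedAlg veronese_gr_grading veronese_gr0P veronese_grM
    veronese_grM_gen veronese_gr1_fin.

End VeroneseSubalgebra.

(* A finitely generated Z-graded module over A. *)
Record gradedModule (K : fieldType) (A : stdGradedAlg K) := GradedModule {
  gmod :> lmodType A;
  mgr : int -> gmod -> Prop;
  mgr_grading : is_grading mgr;
  mgrZ : forall i d (a : A) m, gr i a -> mgr d m -> mgr (i%:Z + d) (a *: m);
  mgr_fg : exists g : seq gmod,
    forall m, exists a : gmod -> A, m = \sum_(y <- g) a y *: y }.

(* B seen as an A-module through f : A -> B *)
Definition pull_module (A B : nzRingType) (f : {rmorphism A -> B}) : Type := B.

Section PullModule.
Variables (A B : nzRingType) (f : {rmorphism A -> B}).
Local Notation M := (pull_module f).

HB.instance Definition _ := GRing.Zmodule.copy M B.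

Definition pull_scale (a : A) (b : M) : M := f a * (b : B).

Lemma pull_scaleA a b v : pull_scale a (pull_scale b v) = pull_scale (a * b) v.
Proof. by rewrite /pull_scale rmorphM mulrA. Qed.
Lemma pull_scale1 : left_id 1 pull_scale.
Proof. by move=> v; rewrite /pull_scale rmorph1 mul1r. Qed.
Lemma pull_scaleDr : right_distributive pull_scale +%R.
Proof. by move=> a u v; rewrite /pull_scale mulrDr. Qed.
Lemma pull_scaleDl v : {morph pull_scale^~ v : a b / a + b}.
Proof. by move=> a b; rewrite /pull_scale rmorphD mulrDl. Qed.

HB.instance Definition _ := GRing.Zmodule_isLmodule.Build A M
  pull_scaleA pull_scale1 pull_scaleDr pull_scaleDl.

Lemma pull_fg (surj : forall b, exists a, f a = b) : exists g : seq M,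
  forall m, exists a : M -> A, m = \sum_(y <- g) a y *: y.
Proof.
exists [:: 1 : B] => m; have [a am] := surj m; exists (fun=> a).
by rewrite big_seq1 /GRing.scale /= /pull_scale mulr1 am.
Qed.

End PullModule.

(* K = A / (+)_(i > 0) A_i, concentrated in degree 0 *)
Section ResidueField.
Variables (K : fieldType) (A : stdGradedAlg K).
Local Notation k := (pull_module (@aug K A)).

Definition residue_gr (d : int) (x : k) : Prop := d <> 0 -> x = 0.

Lemma residue_gr_grading : is_grading residue_gr.
Proof.
split=> // [i x y hx hy i0|x|s r ur hs s0 i ir].
- by rewrite hx // hy // subr0.
- exists (fun d => if d == 0 then x else 0), [:: 0]; split=> //.
    by move=> i /eqP /negPf ->.
  by rewrite big_seq1.
- have [i0|/eqP i0] := eqVneq i 0; last exact: hs.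
  move: s0; rewrite (bigD1_seq i) //= big1 ?addr0 // => j ji.
  by apply: hs; apply/eqP; rewrite -i0.
Qed.

Lemma residue_grZ i d (a : A) (x : k) :
  gr i a -> residue_gr d x -> residue_gr (i%:Z + d) (a *: x).
Proof.
move=> ga hx id0; have [d0|/eqP d0] := eqVneq d 0; last first.
  by rewrite hx // scaler0.
have i0 : (0 == i)%N = false.
  by apply/eqP => i0; apply: id0; rewrite -i0 d0.
suff a0 : aug a = 0 by rewrite -[LHS]/(aug a * (x : K)) a0 mul0r.
apply: (@scale1_inj _ A); rewrite augE /gcomp (comp_homog _ _ ga) i0.
by rewrite scale0r.
Qed.

Lemma aug_surj (x : K) : exists a : A, aug a = x.
Proof.
exists x%:A; apply: (@scale1_inj _ A).
by rewrite augE /gcomp (comp_homog _ _ (grA A x)).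
Qed.

Definition residue : gradedModule A :=
  GradedModule residue_gr_grading residue_grZ (pull_fg aug_surj).

End ResidueField.

Record gradedSurj (K : fieldType) (A B : stdGradedAlg K) := GradedSurj {
  gsurj :> {lrmorphism A -> B};
  gsurj_gr : forall i x, gr i x -> gr i (gsurj x);
  gsurj_surj : forall y, exists x, gsurj x = y }.

Section QuotientModule.
Variables (K : fieldType) (A B : stdGradedAlg K) (f : gradedSurj A B).
Local Notation M := (pull_module (gsurj f)).

Definition quot_gr : int -> M -> Prop := @grz K B.

Lemma quot_grZ i d (a : A) (m : M) :
  gr i a -> quot_gr d m -> quot_gr (i%:Z + d) (a *: m).
Proof.
move=> ga; case: d => [d hm|d -> /=]; first exact: grM (gsurj_gr f ga) hm.
by rewrite scaler0; exact: grading0 (grz_grading B) _.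
Qed.

Definition quotient_module : gradedModule A :=
  GradedModule (grz_grading B : is_grading quot_gr) quot_grZ
    (pull_fg (gsurj_surj f)).

End QuotientModule.

(* A graded free resolution
     ... -> F_2 -> F_1 -> F_0 -> M -> 0
   of M by finitely generated graded free modules. F_i has a homogeneous basis
   e_0, ..., e_(rk i - 1) with e_k of degree deg k, so its elements are row
   vectors of coordinates; the map F_(i+1) -> F_i is v |-> v *m dif i, the map
   F_0 -> M sends e_k to gen k, and all maps preserve degrees. *)
Record freeRes (K : fieldType) (A : stdGradedAlg K) (M : gradedModule A) :=
  FreeRes {
  rk : nat -> nat;
  deg : forall i, 'I_(rk i) -> int;
  dif : forall i, 'M[A]_(rk i.+1, rk i);
  gen : 'I_(rk 0) -> M;
  dif_gr : forall i k l, grz (deg k - deg l) (dif i k l);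
  gen_gr : forall k, mgr (deg k) (gen k);
  gen_surj : forall m : M, exists v : 'rV[A]_(rk 0), m = \sum_k v 0 k *: gen k;
  exact0 : forall v : 'rV[A]_(rk 0),
    \sum_k v 0 k *: gen k = 0 <-> exists w, v = w *m dif 0;
  exactS : forall i (v : 'rV[A]_(rk i.+1)),
    v *m dif i = 0 <-> exists w, v = w *m dif i.+1 }.

Section Tor.
Variables (K : fieldType) (A : stdGradedAlg K) (M : gradedModule A).
Variable F : freeRes M.

(* the differential of F (x)_A K, where F_i (x)_A K = K^(rk i) *)
Definition difK i : 'M[K]_(rk F i.+1, rk F i) := map_mx (@aug K A) (dif F i).

(* the row space of degK i j is the degree j component of F_i (x)_A K *)
Definition degK i (j : int) : 'M[K]_(rk F i) :=
  diag_mx (\row_k (deg k == j)%:R).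

Definition cyclesK i j : 'M[K]_(rk F i) :=
  match i with
  | 0 => degK 0 j
  | i'.+1 => (degK i'.+1 j :&: kermx (difK i'))%MS
  end.

Definition boundariesK i j : 'M[K]_(rk F i.+1, rk F i) :=
  degK i.+1 j *m difK i.

(* dim_K H_i(F (x)_A K)_j; the boundaries are contained in the cycles *)
Definition tor_dim i j : nat := (\rank (cyclesK i j) - \rank (boundariesK i j))%N.

End Tor.

(* beta_ij^A(M) = b. Tor^A(M, K) is computed from a resolution F of M: by the
   comparison theorem tor_dim F i j does not depend on F, and F exists because
   A is Noetherian and M finitely generated. *)
Definition betti (K : fieldType) (A : stdGradedAlg K) (M : gradedModule A)
    (i : nat) (j : int) (b : nat) : Prop :=
  exists F : freeRes M, tor_dim F i j = b.

(* t_i^A(M), which is -oo if Tor_i^A(M, K) = 0 *)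
Definition tsup (K : fieldType) (A : stdGradedAlg K) (M : gradedModule A)
    (i : nat) : \bar Rdefinitions.R :=
  ereal_sup [set (j%:~R)%:E | j in
    [set j : int | exists2 b, b <> 0%N & betti M i j b]].

Definition koszul (K : fieldType) (A : stdGradedAlg K) : Prop :=
  forall (i : nat) (j : int), i%:Z <> j -> betti (residue A) i j 0.

Definition homogeneous_ideal (K : fieldType) (A : stdGradedAlg K)
    (I : A -> Prop) : Prop :=
  [/\ I 0, forall x y, I x -> I y -> I (x + y), forall a x, I x -> I (a * x) &
      forall x, I x -> forall i, I (gcomp i x)].

(* Main.v *)
Require Import Defs.
From HB Require Import structures.
From mathcomp Require Import all_boot all_order all_algebra.
From mathcomp Require Import zify.
From mathcomp Require Import boolp classical_sets reals constructive_ereal ereal Rstruct.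
From mathcomp Require Import -(notations) mpoly.

(* Write H_i(N) for the Koszul homology of a graded R-module N with respect to
   degree one elements x_1, ..., x_n, namely the images in R of the variables
   of S; it is Tor_i^S(N, K). If t_i(R) <= c (i + 1) for all i, then
   H_i(R)_j = 0 for j > c (i + 1): this follows from a minimal free resolution
   of R over S by dimension shifting, since the free S-modules have no higher
   Koszul homology.

   The r-th syzygy module of K over R^(c) is the Veronese module of an R-module
   N_r living in degrees >= c r with H_i(N_r)_j = 0 for j > c (r + i). One
   takes N_1 = R_(>= c). The case i = 0 shows that N_r is generated in degree
   c r, so N_r is a quotient of a free module R(-c r)^b, with kernel N' say.
   The long exact sequence gives H_i(N')_j = 0 for j > c (r + 1 + i), and this
   survives truncation to N_(r+1) = N'_(>= c (r + 1)), which does not change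
   the part in degrees divisible by c. Hence K has a linear resolution over
   R^(c). Koszulness of S^(c) is never needed.

   For (1), S is Noetherian, so that the resolution consists of finitely
   generated modules, and H_i = 0 for i > n. *)

Set Implicit Arguments.
Unset Strict Implicit.
Unset Printing Implicit Defensive.

Import Order.TTheory GRing.Theory Num.Theory.
Local Open Scope ring_scope.

(** * Koszul homology *)

(* The Koszul complex of n commuting endomorphisms of M, all exterior degrees
   together, as an iterated mapping cone: (f, g) stands for f + e_n g. *)
Fixpoint kz (M : zmodType) (n : nat) : zmodType :=
  if n is n'.+1 then (kz M n' * kz M n')%type else M.

Fixpoint kz_map (M M' : zmodType) (p : M -> M') n : kz M n -> kz M' n :=
  if n is n'.+1 return kz M n -> kz M' n
  then fun f => (kz_map p f.1, kz_map p f.2) else p.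

Fixpoint kz_emb (M : zmodType) n (m : M) : kz M n :=
  if n is n'.+1 return kz M n then (kz_emb n' m, 0) else m.

Lemma kz_map_is_additive (M M' : zmodType) (p : {additive M -> M'}) n :
  zmod_morphism (@kz_map M M' p n).
Proof.
elim: n => [|n IH] f g /=; first by rewrite raddfB.
by rewrite !IH.
Qed.

HB.instance Definition _ (M M' : zmodType) (p : {additive M -> M'}) n :=
  GRing.isZmodMorphism.Build (kz M n) (kz M' n) (@kz_map M M' p n)
    (@kz_map_is_additive M M' p n).


(** The rule d(f + e_n g) = d f + x_n g - e_n d g. The minus sign lets the two cross terms x_n d g
    cancel in the square of d. *)
Fixpoint kz_d (M : zmodType) (x : nat -> {additive M -> M}) n : kz M n -> kz M n :=
  if n is n'.+1 return kz M n -> kz M n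
  then fun f => (kz_d x f.1 + kz_map (x n') f.2, - kz_d x f.2) else fun=> 0.

Lemma kz_d_is_additive (M : zmodType) (x : nat -> {additive M -> M}) n :
  zmod_morphism (@kz_d M x n).
Proof.
elim: n => [|n IH] f g /=; first by rewrite subr0.
congr (_, _); rewrite /= IH ?raddfB ?opprD //; exact: addrACA.
Qed.

HB.instance Definition _ (M : zmodType) (x : nat -> {additive M -> M}) n :=
  GRing.isZmodMorphism.Build (kz M n) (kz M n) (@kz_d M x n)
    (@kz_d_is_additive M x n).


(* f has exterior degree i and total degree j, where N d is the degree d
   component of a graded submodule of M; the e_k have degree 1. *)
Fixpoint kz_in (M : zmodType) (N : int -> M -> Prop) n (i : nat) (j : int) :
    kz M n -> Prop :=
  if n is n'.+1 return kz M n -> Prop then fun f =>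
    kz_in N i j f.1 /\ (if i is i'.+1 then kz_in N i' (j - 1) f.2 else f.2 = 0)
  else fun f => if i is 0 then N j f else f = 0.

(** The vanishing H_i(N)_j = 0. Since [N] is a family of predicates on a fixed group, kernels and
    truncations live in the same ambient complex and no new types are formed. *)
Definition kz_acyclic (M : zmodType) (x : nat -> {additive M -> M})
    (N : int -> M -> Prop) n (i : nat) (j : int) : Prop :=
  forall f : kz M n, kz_in N i j f -> kz_d x f = 0 ->
    exists g : kz M n, kz_in N i.+1 j g /\ kz_d x g = f.

Record gsub (M : zmodType) (x : nat -> {additive M -> M})
    (N : int -> M -> Prop) : Prop := GSub {
  gsub0 : forall d, N d 0;
  gsubB : forall d a b, N d a -> N d b -> N d (a - b);
  gsubX : forall d k a, N d a -> N (d + 1) (x k a) }.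

Definition gker (M M' : zmodType) (p : M -> M') (N : int -> M -> Prop) d m :=
  N d m /\ p m = 0.

Definition trunc (M : zmodType) (D : int) (N : int -> M -> Prop) (d : int) m :=
  if D <= d then N d m else m = 0.

Lemma kz_map_comm (M1 M2 M3 M4 : zmodType) (p : M1 -> M2) (q : M2 -> M4)
    (p' : M1 -> M3) (q' : M3 -> M4) n (f : kz M1 n) :
  (forall m, q (p m) = q' (p' m)) ->
  kz_map q (kz_map p f) = kz_map q' (kz_map p' f).
Proof. by move=> h; elim: n f => [|n IH] f //=; rewrite !IH. Qed.

Section Complex.
Variables (M : zmodType) (x : nat -> {additive M -> M}).
Hypothesis xC : forall k l m, x k (x l m) = x l (x k m).

Lemma kz_d_map (M' : zmodType) (y : nat -> {additive M' -> M'})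
    (p : {additive M -> M'}) n (f : kz M n) :
  (forall k m, p (x k m) = y k (p m)) ->
  kz_d y (kz_map p f) = kz_map p (kz_d x f).
Proof.
move=> h; elim: n f => [|n IH] f /=; first by rewrite raddf0.
rewrite !IH raddfD raddfN; congr (_ + _, _).
exact: kz_map_comm.
Qed.

Lemma kz_dd n (f : kz M n) : kz_d x (kz_d x f) = 0.
Proof.
elim: n f => [|n IH] f //=; rewrite !raddfN raddfD /= !IH add0r oppr0.
by rewrite (@kz_d_map M x (x n)) ?subrr ?oppr0 // => k m; exact: xC.
Qed.

Lemma kz_d_emb n (m : M) : kz_d x (kz_emb n m) = 0.
Proof.
elim: n => [|n IH] //=.
by rewrite IH !raddf0 addr0.
Qed.

Lemma kz_emb_is_additive n : zmod_morphism (@kz_emb M n).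
Proof. by elim: n => [|n IH] a b //=; rewrite IH; congr (_, _); rewrite /= subr0. Qed.

HB.instance Definition _ n :=
  GRing.isZmodMorphism.Build M (kz M n) (@kz_emb M n) (@kz_emb_is_additive n).

Lemma kz_map_emb (M' : zmodType) (p : {additive M -> M'}) n (m : M) :
  kz_map p (kz_emb n m) = kz_emb n (p m).
Proof. by elim: n => [|n IH] //=; rewrite IH raddf0. Qed.

Section Graded.
Variables (N : int -> M -> Prop) (GN : gsub x N).

Lemma gsubN d a : N d a -> N d (- a).
Proof. by rewrite -sub0r; apply: (gsubB GN) => //; exact: gsub0 GN d. Qed.

Lemma gsubD d a b : N d a -> N d b -> N d (a + b).
Proof. by move=> ga gb; rewrite -[b]opprK; apply: (gsubB GN) => //; exact: gsubN. Qed.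

Lemma gsub_sum d (I : Type) (r : seq I) (P : pred I) (F : I -> M) :
  (forall i, P i -> N d (F i)) -> N d (\sum_(i <- r | P i) F i).
Proof.
by move=> h; apply: big_ind => //; [exact: gsub0 GN d | move=> a b; exact: gsubD].
Qed.

Lemma kz_in0 n i j : kz_in N i j (0 : kz M n).
Proof.
elim: n i j => [|n IH] i j /=; first by case: i => //; exact: gsub0 GN j.
by split=> //; case: i.
Qed.

Lemma kz_inB n i j (f g : kz M n) :
  kz_in N i j f -> kz_in N i j g -> kz_in N i j (f - g).
Proof.
elim: n i j f g => [|n IH] i j f g /=.
  by case: i => [|i]; [exact: (gsubB GN) | move=> -> ->; rewrite subr0].
case=> f1 f2 [g1 g2]; split; first exact: IH.
by case: i f2 g2 {f1 g1} => [-> ->|i]; [rewrite subr0 | exact: IH].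
Qed.

Lemma kz_inN n i j (f : kz M n) : kz_in N i j f -> kz_in N i j (- f).
Proof. by rewrite -sub0r; apply: kz_inB => //; exact: kz_in0. Qed.

Lemma kz_inD n i j (f g : kz M n) :
  kz_in N i j f -> kz_in N i j g -> kz_in N i j (f + g).
Proof.
by move=> ga gb; rewrite -[g]opprK; apply: kz_inB => //; exact: kz_inN.
Qed.

Lemma kz_in_sum n i j (I : Type) (r : seq I) (F : I -> kz M n) :
  (forall k, kz_in N i j (F k)) -> kz_in N i j (\sum_(k <- r) F k).
Proof.
by move=> h; apply: big_ind => //; [exact: kz_in0 | move=> a b; exact: kz_inD].
Qed.

End Graded.

Lemma kz_in_map (M' : zmodType) (N : int -> M -> Prop) (N' : int -> M' -> Prop)
    (p : {additive M -> M'}) (e : int) n i j (f : kz M n) :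
  (forall d m, N d m -> N' (d + e) (p m)) -> kz_in N i j f ->
  kz_in N' i (j + e) (kz_map p f).
Proof.
move=> h; elim: n i j f => [|n IH] i j f /=.
  by case: i => [/h//|i ->]; rewrite raddf0.
case=> f1 f2; split; first exact: IH.
case: i f1 f2 => [_ ->|i _]; first by rewrite raddf0.
by move/IH; rewrite addrAC.
Qed.

Lemma kz_d_in0 (N : int -> M -> Prop) n j (f : kz M n) :
  kz_in N 0 j f -> kz_d x f = 0.
Proof. by elim: n f => [|n IH] f //= [/IH -> ->]; rewrite !raddf0 addr0. Qed.

Lemma kz_d_in (N : int -> M -> Prop) (GN : gsub x N) n i j (f : kz M n) :
  kz_in N i.+1 j f -> kz_in N i j (kz_d x f).
Proof.
elim: n i j f => [|n IH] i j f /=.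
  by case: i => // _; exact: gsub0 GN j.
case=> f1 f2; split.
  apply: kz_inD => //; first exact: IH.
  rewrite -[j](subrK 1); apply: kz_in_map f2; move=> d m; exact: (gsubX GN).
case: i f1 f2 => [_ /kz_d_in0 ->|i _ f2]; first by rewrite oppr0.
by apply: kz_inN => //; exact: IH.
Qed.

Lemma kz_in_big (N : int -> M -> Prop) n i j (f : kz M n) :
  (n < i)%N -> kz_in N i j f -> f = 0.
Proof.
elim: n i j f => [|n IH] [|i] j f //= ni [f1 f2].
by rewrite [f]surjective_pairing (IH _ _ _ _ f1) ?(IH _ _ _ _ f2) //; lia.
Qed.

Lemma kz_in0P (N : int -> M -> Prop) n j (f : kz M n) :
  kz_in N 0 j f -> exists2 m, N j m & f = kz_emb n m.
Proof.
elim: n f => [|n IH] f /=; first by exists f.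
by case=> /IH[m mN E] f2; exists m => //; rewrite [f]surjective_pairing E f2.
Qed.

Lemma kz_emb_in (N : int -> M -> Prop) n j m :
  N j m -> kz_in N 0 j (kz_emb n m).
Proof. by elim: n => [|n IH] //= /IH. Qed.

(** An element of exterior degree i and total degree j has all its coefficients in degree j - i. *)
Lemma kz_in_trunc (N : int -> M -> Prop) D n i j (f : kz M n) :
  D <= j - i%:Z -> kz_in N i j f -> kz_in (trunc D N) i j f.
Proof.
elim: n i j f => [|n IH] [|i] j f //=.
- by rewrite subr0 /trunc => ->.
- by move=> h [f1 f2]; split=> //; exact: IH.
- move=> h [f1 f2]; split; first exact: IH.
  by apply: IH f2; lia.
Qed.

Lemma kz_in_untrunc (N : int -> M -> Prop) (GN : gsub x N) D n i j (f : kz M n) :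
  kz_in (trunc D N) i j f -> kz_in N i j f.
Proof.
elim: n i j f => [|n IH] i j f /=.
  by case: i => //; rewrite /trunc; case: ifP => // _ ->; exact: gsub0 GN j.
by case=> f1 f2; split; [exact: IH | case: i f2 {f1} => // i; exact: IH].
Qed.

Lemma gsub_trunc (N : int -> M -> Prop) D : gsub x N -> gsub x (trunc D N).
Proof.
move=> GN; split; rewrite /trunc.
- by move=> d; case: ifP => // _; exact: gsub0 GN d.
- by move=> d a b; case: ifP => [_|_ -> ->]; [exact: (gsubB GN) | rewrite subr0].
- move=> d k a; case: ifP => [h|_ ->]; last first.
    by rewrite raddf0; case: ifP => // _; exact: gsub0 GN _.
  by rewrite ifT; [exact: (gsubX GN) | lia].
Qed.

(** The bounding chain has exterior degree i + 1, so its coefficients lie in degree j - i - 1, which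
    is at least [D]. *)
Lemma kz_acyclic_trunc (N : int -> M -> Prop) D n i j : gsub x N ->
  D + i%:Z + 1 <= j -> kz_acyclic x N n i j -> kz_acyclic x (trunc D N) n i j.
Proof.
move=> GN h T f fi f0; have [g [gi gE]] := T f (kz_in_untrunc GN fi) f0.
by exists g; split=> //; apply: kz_in_trunc gi; lia.
Qed.

Lemma kz_acyclic_big (N : int -> M -> Prop) n i j : gsub x N -> (n < i)%N ->
  kz_acyclic x N n i j.
Proof.
move=> GN ni f fi _; exists 0; split; first exact: kz_in0.
by rewrite raddf0 (kz_in_big ni fi).
Qed.

(** In exterior degree one the differential is (u_k) |-> sum of x_k u_k. Each induction step splits
    off the coefficient of the last basis vector. This makes H_0 explicit as N / (x)N. *)
Lemma kz_boundP (N : int -> M -> Prop) n j (m : M) : gsub x N ->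
  (exists g : kz M n, kz_in N 1 j g /\ kz_d x g = kz_emb n m) <->
  (exists2 u : nat -> M, (forall k, N (j - 1) (u k)) &
     m = \sum_(k < n) x k (u k)).
Proof.
move=> GN; elim: n m => [|n IH] m /=.
  split=> [[g [_ <-]]|[u _ ->]]; last by exists 0; rewrite big_ord0.
  by exists (fun=> 0); [move=> k; exact: gsub0 GN _ | rewrite big_ord0].
split=> [[[g1 g2] /= [[g1i /kz_in0P[v vN g2E]] [E _]]]|[u uN mE]].
  rewrite {}g2E in E.
  have /(proj1 (IH _))[u uN uE] : exists g : kz M n,
      kz_in N 1 j g /\ kz_d x g = kz_emb n (m - x n v).
    by exists g1; split=> //; rewrite raddfB /= -E kz_map_emb addrK.
  exists (fun k => if k == n then v else u k) => [k|]; first by case: ifP.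
  rewrite big_ord_recr /= eqxx -[LHS](subrK (x n v)) uE; congr (_ + _).
  by apply: eq_bigr => k _; rewrite ltn_eqF.
have [|g [gi gE]] := (IH (m - x n (u n))).2.
  by exists u => //; rewrite mE big_ord_recr /= addrK.
exists (g, kz_emb n (u n)); split=> /=.
  by split=> //; apply: kz_emb_in.
by rewrite gE kz_d_emb kz_map_emb oppr0 -raddfD subrK.
Qed.

Lemma kz_acyclic0P (N : int -> M -> Prop) n j : gsub x N ->
  kz_acyclic x N n 0 j <->
  forall m, N j m -> exists2 u : nat -> M, (forall k, N (j - 1) (u k)) &
     m = \sum_(k < n) x k (u k).
Proof.
move=> GN; split=> [T m mN|h f /kz_in0P[m mN ->] _].
  by apply/(kz_boundP _ _ _ GN); apply: T; [exact: kz_emb_in | exact: kz_d_emb].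
by apply/(kz_boundP _ _ _ GN); exact: h.
Qed.

End Complex.

(** * Exact sequences of Koszul homology for a surjection and its kernel *)

Section Exact.
Variables (M M' : zmodType) (x : nat -> {additive M -> M}).
Variables (y : nat -> {additive M' -> M'}) (p : {additive M -> M'}).
Hypotheses (xC : forall k l m, x k (x l m) = x l (x k m))
  (pxy : forall k m, p (x k m) = y k (p m)).

Lemma gsub_ker N : gsub x N -> gsub x (gker p N).
Proof.
move=> GN; split=> [d|d a b [ha pa] [hb pb]|d k a [ha pa]].
- by split; [exact: gsub0 GN d | rewrite raddf0].
- by split; [exact: (gsubB GN) | rewrite raddfB pa pb subr0].
- by split; [exact: (gsubX GN) | rewrite pxy pa raddf0].
Qed.

Lemma kz_in_ker N n i j (f : kz M n) : kz_in N i j f -> kz_map p f = 0 ->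
  kz_in (gker p N) i j f.
Proof.
elim: n i j f => [|n IH] i j f /=; first by case: i.
case=> f1 f2 [p1 p2]; split; first exact: IH.
by case: i f2 {f1} => // i f2; exact: IH.
Qed.

Lemma kz_ker_in N n i j (f : kz M n) : kz_in (gker p N) i j f ->
  kz_in N i j f /\ kz_map p f = 0.
Proof.
elim: n i j f => [|n IH] i j f /=.
  by case: i => [//|i ->]; rewrite raddf0.
case=> /IH[f1 ->] f2; case: i f2 f1 => [-> //|i /IH[f2 ->] //].
by rewrite raddf0.
Qed.

Variables (F : int -> M -> Prop) (N : int -> M' -> Prop).
Hypotheses (GF : gsub x F) (GN : gsub y N).
Hypotheses (pF : forall d m, F d m -> N d (p m))
  (pS : forall d m, N d m -> exists2 m', F d m' & p m' = m).

Lemma kz_lift n i j (f : kz M' n) : kz_in N i j f ->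
  exists2 g : kz M n, kz_in F i j g & kz_map p g = f.
Proof.
elim: n i j f => [|n IH] i j f /=.
  by case: i => [/pS//|i ->]; exists 0; rewrite ?raddf0.
case=> /IH[g1 g1i E1] f2.
have [g2 g2i E2] : exists2 g2 : kz M n,
    if i is i'.+1 then kz_in F i' (j - 1) g2 else g2 = 0 & kz_map p g2 = f.2.
  case: i f2 {g1i} => [->|i /IH //]; by exists 0; rewrite ?raddf0.
by exists (g1, g2) => //=; rewrite E1 E2 -surjective_pairing.
Qed.

Lemma kz_in_surj n i j (f : kz M n) : kz_in F i j f -> kz_in N i j (kz_map p f).
Proof.
move=> fi; rewrite -[j]addr0; apply: kz_in_map fi => d m /pF.
by rewrite addr0.
Qed.

(* H_(i+1)(N) -> H_i(ker p) -> H_i(F) *)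
Lemma kz_acyclic_ker n i j : kz_acyclic y N n i.+1 j -> kz_acyclic x F n i j ->
  kz_acyclic x (gker p F) n i j.
Proof.
move=> TN TF f /kz_ker_in[fi pf] df.
have [g [gi gE]] := TF f fi df.
have [h [hi hE]] : exists h, kz_in N i.+2 j h /\ kz_d y h = kz_map p g.
  by apply: TN; [exact: kz_in_surj | rewrite (kz_d_map _ pxy) gE].
(* The chain [g] bounds [f] but need not lie in the kernel. Subtracting d of a lift of [h] moves it
   there without changing its boundary. *)
have [h' h'i h'E] := kz_lift hi.
exists (g - kz_d x h'); split; last by rewrite raddfB /= kz_dd // subr0.
apply: kz_in_ker; first by apply: (kz_inB GF) => //; exact: (kz_d_in GF).
by rewrite raddfB /= -(kz_d_map _ pxy) h'E hE subrr.
Qed.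

(* H_(i+1)(F) -> H_(i+1)(N) -> H_i(ker p) *)
Lemma kz_acyclic_coker n i j :
  kz_acyclic x F n i.+1 j -> kz_acyclic x (gker p F) n i j ->
  kz_acyclic y N n i.+1 j.
Proof.
move=> TF TK f fi df; have [g gi gE] := kz_lift fi.
(* The lift [g] of the cycle [f] need not be a cycle, but its boundary is a cycle of the kernel. If
   [h] bounds it there, [g - h] is a cycle that still lifts [f]. *)
have [||h [/kz_ker_in[hi ph] hE]] := TK (kz_d x g).
- apply: kz_in_ker; first exact: (kz_d_in GF).
  by rewrite -(kz_d_map _ pxy) gE.
- exact: kz_dd.
have [||u [ui uE]] := TF (g - h).
- exact: (kz_inB GF).
- by rewrite raddfB /= hE subrr.
exists (kz_map p u); split; first exact: kz_in_surj.
by rewrite (kz_d_map _ pxy) uE raddfB /= ph subr0.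
Qed.

Lemma kz_acyclic0_surj n j : kz_acyclic x F n 0 j -> kz_acyclic y N n 0 j.
Proof.
move=> /(kz_acyclic0P _ _ GF) T; apply/(kz_acyclic0P _ _ GN) => m /pS[m' m'F <-].
have [u uF ->] := T _ m'F; exists (fun k => p (u k)) => [k|]; first exact: pF.
by rewrite raddf_sum; apply: eq_bigr => k _; exact: pxy.
Qed.

End Exact.

(** Meant for a finite direct sum of shifted copies of [M']: the coordinates [pi k] of a cycle are
    bounded separately, and the inclusions [iota k] reassemble the chains. *)
Lemma kz_acyclic_sum (M M' : zmodType) (x : nat -> {additive M -> M})
    (y : nat -> {additive M' -> M'}) (I : finType) (a : I -> int)
    (pi : I -> {additive M -> M'}) (iota : I -> {additive M' -> M})
    (N : int -> M -> Prop) (N' : int -> M' -> Prop) n i j :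
  gsub x N ->
  (forall k l m, pi k (x l m) = y l (pi k m)) ->
  (forall k l m, iota k (y l m) = x l (iota k m)) ->
  (forall k d m, N d m -> N' (d - a k) (pi k m)) ->
  (forall k d m, N' d m -> N (d + a k) (iota k m)) ->
  (forall m, m = \sum_k iota k (pi k m)) ->
  (forall k, kz_acyclic y N' n i (j - a k)) -> kz_acyclic x N n i j.
Proof.
move=> GN piC iotaC piN iotaN piE T f fi df.
have /fin_all_exists[g gP] k : exists g : kz M' n,
    kz_in N' i.+1 (j - a k) g /\ kz_d y g = kz_map (pi k) f.
  apply: T; first by apply: kz_in_map fi => d m; exact: piN.
  by rewrite (kz_d_map _ (piC k)) df raddf0.
exists (\sum_k kz_map (iota k) (g k)); split.
  apply: (kz_in_sum GN) => k; rewrite -[j](subrK (a k)).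
  by apply: kz_in_map (gP k).1 => d m; exact: iotaN.
rewrite raddf_sum.
move=> /=.
transitivity (\sum_k kz_map (iota k) (kz_map (pi k) f)).
  by apply: eq_bigr => k _; rewrite /= (kz_d_map _ (iotaC k)) (gP k).2.
elim: n f {fi df T g gP} => [|n IH] f /=; first by rewrite -piE.
rewrite [RHS]surjective_pairing -[in RHS](IH f.1) -[in RHS](IH f.2).
elim: (index_enum _) => [|k r IHr]; first by rewrite !big_nil.
by rewrite !big_cons IHr.
Qed.

(** * Graded free modules *)

(* Applied both with C = A, and with A a K-algebra and C = K. *)
Lemma exists_minimal_gens (A : comNzRingType) (M : lmodType A) (C : A -> Prop)
    (Q L : M -> Prop) :
  (forall a b, C a -> C b -> C (a - b)) -> (forall a b, C a -> C b -> C (a * b)) ->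
  (exists m (G : 'I_m -> M), (forall k, Q (G k)) /\ forall v, L v <->
     exists2 w : 'I_m -> A, (forall k, C (w k)) & v = \sum_k w k *: G k) ->
  exists m (G : 'I_m -> M), [/\ forall k, Q (G k),
    forall v, L v <->
     exists2 w : 'I_m -> A, (forall k, C (w k)) & v = \sum_k w k *: G k &
    forall w : 'I_m -> A, (forall k, C (w k)) -> \sum_k w k *: G k = 0 ->
      forall k a, C a -> a * w k <> 1].
Proof.
move=> CB CM exG.
have exG' : exists m, `[< exists G : 'I_m -> M, (forall k, Q (G k)) /\ forall v, L v <->
     exists2 w : 'I_m -> A, (forall k, C (w k)) & v = \sum_k w k *: G k >].
  by have [m hm] := exG; exists m; apply/asboolP.
case: (ex_minnP exG') => m /asboolP[G [GQ GL]] mmin; exists m, G; split=> //.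
move=> w wC w0 k a aC awk.
case: m k G GQ GL mmin w wC w0 awk => [[]//|m] k G GQ GL mmin w wC w0 awk.
(* A relation with a unit coefficient at [k] expresses [G k] through the other generators, against
   the minimality of [m]. *)
suff /mmin : `[< exists G : 'I_m -> M, (forall k, Q (G k)) /\ forall v, L v <->
     exists2 w : 'I_m -> A, (forall k, C (w k)) & v = \sum_k w k *: G k >].
  by rewrite ltnn.
have C0 : C 0 by rewrite -(subrr a); exact: CB.
apply/asboolP; exists (fun i => G (lift k i)); split=> // v; split.
  (* The new coefficients come from substituting [G k], which is -a times the sum of the remaining
     terms of the relation. *)
  move=> /GL[u uC ->]; exists (fun i => u (lift k i) - u k * a * w (lift k i)).
    by move=> i; have := CM _ _ (CM _ _ (uC k) aC) (wC (lift k i)); exact: CB.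
  rewrite (bigD1_ord k) //=; under [RHS]eq_bigr => i _ do rewrite scalerBl -scalerA.
  rewrite sumrB addrC -scaler_sumr; congr (_ + _).
  move/eqP: w0; rewrite (bigD1_ord k) //= addrC addr_eq0 => /eqP ->.
  by rewrite scalerN opprK scalerA -mulrA awk mulr1.
move=> [u uC ->]; apply/GL; exists (fun i => oapp u 0 (unlift k i)).
  by move=> i; case: (unlift k i) => //=.
rewrite (bigD1_ord k) //= unlift_none scale0r add0r.
by apply: eq_bigr => i _; rewrite liftK.
Qed.

Section FreeGraded.
Variables (K : fieldType) (A : stdGradedAlg K).
Local Notation hc := (hcomp (grz_grading A)).

Lemma grz0 d : grz d (0 : A).
Proof. exact: grading0 (grz_grading A) d. Qed.

Lemma grzB d (a b : A) : grz d a -> grz d b -> grz d (a - b).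
Proof. exact: (gradingB (grz_grading A)). Qed.

Lemma grzM d e (a b : A) : grz d a -> grz e b -> grz (d + e) (a * b).
Proof.
case: d => d; last by move=> ->; rewrite mul0r => _; exact: grz0.
case: e => e; last by move=> _ ->; rewrite mulr0; exact: grz0.
exact: grM.
Qed.

Lemma hcM d e (a b : A) : grz e b -> hc d (a * b) = hc (d - e) a * b.
Proof.
move=> gb; rewrite {1}[a](compE (grz_grading A)) mulr_suml comp_sum.
rewrite [in RHS](compE (grz_grading A) a) comp_sum mulr_suml.
apply: eq_bigr => i _; have gi := comp_gr (grz_grading A) i a.
rewrite (comp_homog _ _ (grzM gi gb)) (comp_homog _ _ gi) subr_eq.
by case: eqP; rewrite ?mul0r.
Qed.

Definition fgr b (deg : 'I_b -> int) (d : int) (v : 'rV[A]_b) : Prop :=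
  forall k, grz (d - deg k) (v 0 k).

Definition fcomp b (deg : 'I_b -> int) (d : int) (v : 'rV[A]_b) : 'rV[A]_b :=
  \row_k hc (d - deg k) (v 0 k).

Lemma fcomp_gr b (deg : 'I_b -> int) d v : fgr deg d (fcomp deg d v).
Proof. by move=> k; rewrite mxE; exact: comp_gr. Qed.

Lemma fcomp0 b (deg : 'I_b -> int) d : fcomp deg d 0 = 0.
Proof. by apply/rowP => k; rewrite !mxE comp0. Qed.

Lemma fcomp_sum b (deg : 'I_b -> int) (v : 'rV[A]_b) :
  exists s : seq int, v = \sum_(d <- s) fcomp deg d v.
Proof.
pose s := undup [seq e + deg k | k <- enum 'I_b,
                  e <- hsupp (grz_grading A) (v 0 k)].
exists s; apply/rowP => k; rewrite summxE.
under eq_bigr => d _ do rewrite mxE.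
pose g d := d - deg k.
rewrite -(big_map g predT (fun e => hc e (v 0 k))) [LHS](compE (grz_grading A)).
apply: sum_widen.
- exact: hsupp_uniq.
- rewrite map_inj_uniq ?undup_uniq //; exact: addIr.
- move=> e ek; apply/mapP; exists (e + deg k); last by rewrite /g addrK.
  by rewrite mem_undup; apply/allpairsPdep; exists k, e; rewrite mem_enum.
- by move=> e; exact: comp_out.
Qed.

Definition fhom b b' (deg : 'I_b -> int) (deg' : 'I_b' -> int)
    (D : 'M[A]_(b, b')) : Prop := forall k l, grz (deg k - deg' l) (D k l).

Lemma fcomp_mul b b' (deg : 'I_b -> int) (deg' : 'I_b' -> int) D d v :
  fhom deg deg' D -> fcomp deg' d (v *m D) = fcomp deg d v *m D.
Proof.
move=> hD; apply/rowP => l; rewrite !mxE comp_sum; apply: eq_bigr => k _.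
rewrite (hcM _ _ (hD k l)) mxE; congr (hc _ _ * _).
by rewrite opprB addrA subrK.
Qed.

Lemma fgr_mul b b' (deg : 'I_b -> int) (deg' : 'I_b' -> int) D d v :
  fhom deg deg' D -> fgr deg d v -> fgr deg' d (v *m D).
Proof.
move=> hD hv l; rewrite mxE; apply: (grading_sum (grz_grading A)) => k _.
by have := grzM (hv k) (hD k l); rewrite addrA subrK.
Qed.

(** A homogeneous matrix commutes with taking components, so the components of a kernel vector are
    in the kernel. Exactness may therefore be tested on homogeneous vectors. *)
Lemma fhom_exact a b b' (deg : 'I_b -> int)
    (deg' : 'I_b' -> int) (D2 : 'M[A]_(a, b)) (D1 : 'M[A]_(b, b')) :
  fhom deg deg' D1 -> D2 *m D1 = 0 ->
  (forall d v, fgr deg d v -> v *m D1 = 0 -> exists w : 'rV_a, v = w *m D2) ->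
  forall v : 'rV_b, v *m D1 = 0 <-> exists w : 'rV_a, v = w *m D2.
Proof.
move=> h1 D21 H v; split=> [v0|[w ->]]; last by rewrite -mulmxA D21 mulmx0.
have [s ->] := fcomp_sum deg v.
apply: (big_ind (fun u => exists w : 'rV_a, u = w *m D2)).
  by exists 0; rewrite mul0mx.
  by move=> _ _ [w ->] [u ->]; exists (w + u); rewrite mulmxDl.
move=> d _; apply: (H d); first exact: fcomp_gr.
by rewrite -(fcomp_mul _ _ h1) v0 fcomp0.
Qed.

Section Action.
Variables (x : nat -> A) (gx : forall k, gr 1 (x k)).

Definition xscale (M : lmodType A) (k : nat) : {additive M -> M} := *:%R (x k).
Definition xmul : nat -> {additive A -> A} := xscale A^o.

Lemma xmulC k l m : xmul k (xmul l m) = xmul l (xmul k m).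
Proof. exact: mulrCA. Qed.

Lemma xscaleC (M : lmodType A) k l (m : M) :
  xscale M k (xscale M l m) = xscale M l (xscale M k m).
Proof. by rewrite /= !scalerA mulrC. Qed.

Lemma grz_sub : gsub xmul (@grz _ A).
Proof.
split; [exact: grz0 | exact: grzB |].
move=> d k a ga; rewrite addrC; exact: (@grzM 1 d _ _ (gx k) ga).
Qed.

Lemma fgr_scale b (deg : 'I_b -> int) d i (a : A) v : gr i a -> fgr deg d v ->
  fgr deg (i%:Z + d) (a *: v).
Proof.
move=> ga gv k; rewrite mxE -addrA; exact: (@grzM i _ _ _ ga (gv k)).
Qed.

Lemma fgr_sub b (deg : 'I_b -> int) : gsub (xscale 'rV[A]_b) (fgr deg).
Proof.
split.
- by move=> d k; rewrite mxE; exact: grz0.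
- by move=> d v w hv hw k; rewrite !mxE; exact: grzB.
- by move=> d k a ga; rewrite addrC; exact: (fgr_scale (gx k) ga).
Qed.

Definition coord b (k : 'I_b) (v : 'rV[A]_b) : A := v 0 k.
Lemma coord_is_additive b k : zmod_morphism (@coord b k).
Proof. by move=> v w; rewrite /coord !mxE. Qed.
HB.instance Definition _ b k :=
  GRing.isZmodMorphism.Build 'rV[A]_b A (@coord b k) (@coord_is_additive b k).

Definition incl b (k : 'I_b) (a : A) : 'rV[A]_b := a *: delta_mx 0 k.
Lemma incl_is_additive b k : zmod_morphism (@incl b k).
Proof. by move=> v w; rewrite /incl scalerBl. Qed.
HB.instance Definition _ b k :=
  GRing.isZmodMorphism.Build A 'rV[A]_b (@incl b k) (@incl_is_additive b k).

(** A graded free module is a direct sum of copies of A shifted by the basis degrees. *)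
Lemma fgr_acyclic b (deg : 'I_b -> int) n i j :
  (forall k, kz_acyclic xmul (@grz _ A) n i (j - deg k)) ->
  kz_acyclic (xscale 'rV[A]_b) (fgr deg) n i j.
Proof.
apply: (@kz_acyclic_sum _ _ (xscale 'rV[A]_b) xmul _ deg (@coord b) (@incl b)).
- exact: fgr_sub.
- by move=> k l m; rewrite /= /coord mxE.
- by move=> k l m; rewrite /= /incl scalerA.
- by move=> k d v hv; exact: hv.
- move=> k d a ha l; rewrite !mxE eqxx /=; have [->|lk] := eqVneq l k.
    by rewrite mulr1 addrK.
  by rewrite mulr0; exact: grz0.
- by move=> v; rewrite [LHS]row_sum_delta.
Qed.

End Action.
End FreeGraded.

(** * The linear resolution over the Veronese subalgebra *)

(** Take a matrix of maximal rank with row space inside [P]: adjoining a vector of [P] cannot raise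
    the rank. This supplies finite bases for subspaces given only by a predicate. *)
Lemma subspace_rowspace (K : fieldType) q (P : 'rV[K]_q -> Prop) :
  P 0 -> (forall u v, P u -> P v -> P (u + v)) ->
  (forall a u, P u -> P (a *: u)) ->
  exists U : 'M[K]_q, forall u, P u <-> (u <= U)%MS.
Proof.
move=> P0 PD PZ.
pose good (U : 'M[K]_q) := forall u : 'rV_q, (u <= U)%MS -> P u.
have ex0 : exists r, `[< exists2 U, good U & \rank U = r >].
  exists 0%N; apply/asboolP; exists 0; last exact: mxrank0.
  by move=> u; rewrite submx0 => /eqP ->.
have le_q r : `[< exists2 U, good U & \rank U = r >] -> (r <= q)%N.
  by move=> /asboolP[U _ <-]; exact: rank_leq_row.
case: (ex_maxnP ex0 le_q) => r /asboolP[U gU rU] rmax.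
exists U => u; split=> [Pu|]; last exact: gU.
suff gUu : good (U + u)%MS.
  have /rmax : `[< exists2 V, good V & \rank V = \rank (U + u)%MS >].
    by apply/asboolP; exists (U + u)%MS.
  rewrite -rU (geq_leqif (mxrank_leqif_sup (addsmxSl U u))).
  exact: submx_trans (addsmxSr U u).
move=> v /sub_addsmxP[[w1 w2] /= ->]; apply: PD.
  by apply: gU; exact: submxMl.
by rewrite [w2]mx11_scalar mul_scalar_mx; exact: PZ.
Qed.

Section Augmentation.
Variables (K : fieldType) (B : stdGradedAlg K).

Lemma aug_grz d (a : B) : grz d a -> d <> 0 -> aug a = 0.
Proof.
move=> ga d0; apply: (@scale1_inj _ B); rewrite augE scale0r.
case: d ga d0 => [d|d -> _]; last by rewrite /gcomp comp0.
by move=> ga d0; rewrite /gcomp (comp_homog (gr_grading B) _ (ga : gr d a));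
  case: eqP => // E; case: d0; rewrite -E.
Qed.

Lemma aug_gr0 (a : B) : gr 0 a -> a = (aug a)%:A.
Proof. by move=> ga; rewrite augE /gcomp (comp_homog _ _ ga) eqxx. Qed.

Lemma aug_comp0 (a : B) : aug (hcomp (grz_grading B) 0 a) = aug a.
Proof.
rewrite {1}[a](compE (grz_grading B)) comp_sum.
rewrite [in RHS](compE (grz_grading B) a) !raddf_sum; apply: eq_bigr => d _ /=.
have gd := comp_gr (grz_grading B) d a.
rewrite (comp_homog _ _ gd); case: eqP => // d0.
by rewrite raddf0 (aug_grz gd) // => E; case: d0.
Qed.

End Augmentation.

Section Veronese.
Variables (K : fieldType) (R : stdGradedAlg K) (c : nat).
Hypothesis c_gt0 : (0 < c)%N.
Variables (n : nat) (x : nat -> R).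
Hypothesis gx : forall k, gr 1 (x k).
Hypothesis acR : forall (i : nat) (j : int), (c * i.+1)%:Z < j ->
  kz_acyclic (xmul x) (@grz _ R) n i j.

(* sN is the module N_(r+1) of the header, inside a free module with basis in
   degree c r. *)
Record stage (r : nat) := Stage {
  sb : nat;
  sN : int -> 'rV[R]_sb -> Prop;
  sN_sub : gsub (xscale x 'rV[R]_sb) sN;
  sN_M : forall i d (a : R) v, gr i a -> sN d v -> sN (i%:Z + d) (a *: v);
  sN_deg : forall d v, sN d v -> fgr (fun=> (c * r)%:Z) d v;
  sN_low : forall d v, d < (c * r.+1)%:Z -> sN d v -> v = 0;
  sN_ac : forall (i : nat) (j : int), (c * (r.+1 + i))%:Z < j ->
    kz_acyclic (xscale x 'rV[R]_sb) sN n i j }.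

Lemma trunc_M b (N : int -> 'rV[R]_b -> Prop) D :
  (forall d, N d 0) ->
  (forall i d (a : R) v, gr i a -> N d v -> N (i%:Z + d) (a *: v)) ->
  forall i d (a : R) v, gr i a -> trunc D N d v -> trunc D N (i%:Z + d) (a *: v).
Proof.
move=> N0 NM i d a v ga; rewrite /trunc; case: ifP => [Dd h|_ ->].
  by rewrite ifT; [exact: NM | lia].
by rewrite scaler0; case: ifP.
Qed.

Lemma stage_zero_sub : gsub (xscale x 'rV[R]_1) (fgr (fun=> 0)).
Proof. exact: fgr_sub. Qed.

(** The truncation R_(>= c), inside the free module of rank one. As c > 0, the bound c (i + 1) < j
    implies c + i + 1 <= j, so truncation keeps the vanishing assumed in [acR]. *)
Definition stage_zero : stage 0.
Proof.
apply: (@Stage 0 1 (trunc c%:Z (fgr (fun=> 0)))).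
- exact: gsub_trunc stage_zero_sub.
- by apply: trunc_M; [exact: gsub0 stage_zero_sub | move=> i d a v; exact: fgr_scale].
- move=> d v; rewrite muln0 /trunc; case: ifP => // _ ->.
  exact: gsub0 stage_zero_sub d.
- by move=> d v; rewrite muln1 /trunc; case: ifP => //; lia.
- move=> i j h; apply: kz_acyclic_trunc; [exact: stage_zero_sub | nia |].
  by apply: fgr_acyclic => // k; rewrite subr0; apply: acR; rewrite -add1n.
Defined.

Section Step.
Variables (r : nat) (s : stage r).
Let N := @sN r s.
Let e := (c * r.+1)%:Z.

(** A vector of [N e] has coordinates in degree e - c r = c, and R_c has a finite spanning set [g].
    The map [t] parametrizes such vectors by coefficients in K, and the preimage of [N e] is a row
    space. *)
Lemma stage_gens : exists m (G : 'I_m -> 'rV[R]_(sb s)),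
  (forall k, N e (G k)) /\ forall v, N e v <->
     exists2 w : 'I_m -> R, (forall k, exists a : K, w k = a%:A) &
       v = \sum_k w k *: G k.
Proof.
have [g gg gP] := gr_fin R c.
pose m := size g.
pose t (u : 'rV[K]_(sb s * m)) : 'rV[R]_(sb s) :=
  \row_l \sum_(k < m) (vec_mx u l k) *: g`_k.
have tD u v : t (u + v) = t u + t v.
  apply/rowP => l; rewrite !mxE -big_split; apply: eq_bigr => k _.
  by rewrite linearD mxE scalerDl.
have t0 : t 0 = 0.
  by apply/rowP => l; rewrite !mxE big1 // => k _; rewrite linear0 mxE scale0r.
have tZ a u : t (a *: u) = a%:A *: t u.
  apply/rowP => l; rewrite !mxE mulr_algl scaler_sumr; apply: eq_bigr => k _.
  by rewrite linearZ mxE scalerA.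
have NA (a : K) v : N e v -> N e (a%:A *: v).
  by move=> Nv; rewrite -[e]add0r; apply: (@sN_M _ s 0) => //; exact: grA.
have [|||U UP] := @subspace_rowspace K _ (fun u => N e (t u)).
- by rewrite t0; exact: gsub0 (sN_sub s) e.
- by move=> u v Nu Nv; rewrite tD; exact: (gsubD (sN_sub s)).
- by move=> a u Nu; rewrite tZ; exact: NA.
have NU k : N e (t (row k U)) by apply/UP; exact: row_sub.
exists (sb s * m)%N, (fun k => t (row k U)); split=> // v; split; last first.
  case=> w wA ->; apply: (gsub_sum (sN_sub s)) => k _.
  by have [a ->] := wA k; exact: NA.
move=> Nv.
have /fin_all_exists[a aP] (l : 'I_(sb s)) : exists a : R -> K,
    v 0 l = \sum_(y <- g) a y *: y.
  apply: gP; have := sN_deg Nv l.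
  by rewrite (_ : e - (c * r)%:Z = c%:Z); [|rewrite /e; lia].
have vE : v = t (mxvec (\matrix_(l, k) a l g`_k)).
  apply/rowP => l; rewrite mxE aP (big_nth 0) big_mkord mxvecK.
  by apply: eq_bigr => k _; rewrite mxE.
move: Nv; rewrite vE => /UP/submxP[w ->].
exists (fun k => (w 0 k)%:A); first by move=> k; exists (w 0 k).
rewrite mulmx_sum_row (big_morph t tD t0); apply: eq_bigr => k _.
exact: tZ.
Qed.

(** A minimal spanning set over K is independent, because a nonzero scalar in a relation is
    invertible. *)
Lemma stage_basis : exists b (D : 'M[R]_(b, sb s)), [/\ forall k, N e (row k D),
  forall v, N e v -> exists a : 'I_b -> K, v = (\row_k (a k)%:A) *m D &
  forall a : 'I_b -> K, (\row_k (a k)%:A) *m D = 0 -> forall k, a k = 0].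
Proof.
have [||b [G [NG GP Gi]]] := @exists_minimal_gens R 'rV[R]_(sb s)
  (fun w => exists a : K, w = a%:A) (N e) (N e) _ _ stage_gens.
- by move=> _ _ [a ->] [a' ->]; exists (a - a'); rewrite scalerBl.
- move=> _ _ [a ->] [a' ->]; exists (a * a').
  by rewrite -scalerAl mul1r scalerA.
exists b, (\matrix_k G k); have rowG k : row k (\matrix_k G k) = G k.
  exact: rowK.
have aE (a : 'I_b -> K) :
    \row_k (a k)%:A *m (\matrix_k G k) = \sum_k (a k)%:A *: G k.
  by rewrite mulmx_sum_row; apply: eq_bigr => k _; rewrite rowG mxE.
split=> [k|v /GP[w wA ->]|a]; first by rewrite rowG.
  have /fin_all_exists[a aP] := wA; exists a; rewrite aE.
  by apply: eq_bigr => k _; rewrite aP.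
rewrite aE => a0 k; apply/eqP; case: (eqVneq (a k) 0) => // ak.
have := Gi (fun k => (a k)%:A) (fun k => ex_intro _ (a k) erefl) a0 k (a k)^-1%:A.
case; first by exists (a k)^-1.
by rewrite -scalerAl mul1r scalerA mulVf // scale1r.
Qed.

Definition next_dim : nat := sval (cid stage_basis).
Definition next_mx : 'M[R]_(next_dim, sb s) := sval (cid (svalP (cid stage_basis))).

Let D := next_mx.
Let dg : 'I_next_dim -> int := fun=> e.

Lemma next_in k : N e (row k D).
Proof. by have [] := svalP (cid (svalP (cid stage_basis))). Qed.

Lemma next_span v : N e v -> exists a : 'I_next_dim -> K, v = (\row_k (a k)%:A) *m D.
Proof. by have [_ h _] := svalP (cid (svalP (cid stage_basis))); exact: h. Qed.

Lemma next_free (a : 'I_next_dim -> K) :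
  (\row_k (a k)%:A) *m D = 0 -> forall k, a k = 0.
Proof. by have [_ _] := svalP (cid (svalP (cid stage_basis))); apply. Qed.

Lemma next_fhom : fhom dg (fun=> (c * r)%:Z) D.
Proof. by move=> k l; have := sN_deg (next_in k) l; rewrite mxE. Qed.

Lemma next_image d v : fgr dg d v -> N d (v *m D).
Proof.
move=> gv; rewrite mulmx_sum_row; apply: (gsub_sum (sN_sub s)) => k _.
have := gv k; case E : (d - dg k) => [i|i] /= ga; last first.
  by rewrite ga scale0r; exact: gsub0 (sN_sub s) d.
have -> : d = i%:Z + e by rewrite -E subrK.
exact: sN_M (next_in k).
Qed.

(** The stage is generated in degree [e]: it vanishes below, and above [e] the vanishing of H_0
    writes each element as a sum of x_k u_k with u_k one degree lower. *)
Lemma next_surj d v : N d v -> exists2 w, fgr dg d w & w *m D = v.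
Proof.
have [de|] := ltP d e.
  move=> /(sN_low de) ->; exists 0; last exact: mul0mx.
  exact: gsub0 (fgr_sub gx dg) d.
move=> ed; have [p ->] : exists p : nat, d = e + p%:Z.
  by exists `|d - e|%N; lia.
elim: p {d ed} v => [|p IH] v.
  rewrite addr0 => /next_span[a ->]; exists (\row_k (a k)%:A) => // k.
  by rewrite mxE /dg subrr; exact: grA.
have T : kz_acyclic (xscale x 'rV[R]_(sb s)) N n 0 (e + p.+1%:Z).
  by apply: sN_ac; rewrite /e addn0; lia.
move=> /(proj1 (kz_acyclic0P _ _ (sN_sub s)) T)[u uN ->].
have uN' k : N (e + p%:Z) (u k) by have := uN k; rewrite (_ : _ - 1 = e + p%:Z) //; lia.
have /choice[w wP] k : exists w, fgr dg (e + p%:Z) w /\ w *m D = u k.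
  by have [w] := IH _ (uN' k); exists w.
exists (\sum_(k < n) x k *: w k); last first.
  rewrite mulmx_suml; apply: eq_bigr => k _.
  by rewrite -scalemxAl (wP k).2.
apply: (gsub_sum (fgr_sub gx dg)) => k _.
rewrite (_ : e + p.+1%:Z = 1%N%:Z + (e + p%:Z)); last by lia.
exact: fgr_scale (gx k) (wP k).1.
Qed.

Definition mulD : {additive 'rV[R]_next_dim -> 'rV[R]_(sb s)} := mulmxr D.

Definition nextN := trunc (c * r.+2)%:Z (gker mulD (fgr dg)).

Lemma mulDx k m :
  mulD (xscale x 'rV[R]_next_dim k m) = xscale x 'rV[R]_(sb s) k (mulD m).
Proof. by rewrite /= -scalemxAl. Qed.

Lemma ker_sub : gsub (xscale x 'rV[R]_next_dim) (gker mulD (fgr dg)).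
Proof. by apply: gsub_ker mulDx _ _; exact: fgr_sub. Qed.

(** For j > c (r + 2 + i) both neighbours of H_i(ker)_j vanish: H_(i+1) of the present stage by
    [sN_ac], and H_i of the free module because j - e > c (i + 1). *)
Definition next : stage r.+1.
Proof.
apply: (@Stage r.+1 next_dim nextN).
- exact: gsub_trunc ker_sub.
- apply: trunc_M; first exact: gsub0 ker_sub.
  move=> i d a v ga [gv v0]; split; first exact: fgr_scale.
  by rewrite /= -scalemxAl (v0 : v *m D = 0) scaler0.
- move=> d v; rewrite /nextN /trunc; case: ifP => [_ []//|_ ->].
  exact: gsub0 (fgr_sub gx dg) d.
- by move=> d v; rewrite /nextN /trunc; case: ifP => //; lia.
- move=> i j h; apply: kz_acyclic_trunc; [exact: ker_sub | nia |].
  apply: (@kz_acyclic_ker _ _ _ _ mulD _ mulDx _ N).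
  + exact: xscaleC.
  + exact: fgr_sub.
  + exact: next_image.
  + exact: next_surj.
  + by apply: sN_ac; nia.
  + by apply: fgr_acyclic => // k; apply: acR; rewrite /dg /e; nia.
Defined.

(** Truncation loses nothing in degrees c m. For m <= r the coordinates have negative degree; for m
    = r + 1 they are scalars, and the rows of [D] are independent over K. *)
Lemma next_ker (m : int) v : fgr dg (c%:Z * m) v -> v *m D = 0 -> nextN (c%:Z * m) v.
Proof.
move=> gv vD; rewrite /nextN /trunc; case: ifP => [_|/negbT h]; first by split.
have [E|mr] := eqVneq m r.+1%:Z; last first.
  apply/rowP => k; have := gv k; rewrite mxE /dg /e.
  by case E : (_ - _) => [i|i] //; nia.
move: gv vD; rewrite E {}/dg /e => gv vD.
have /fin_all_exists[a aP] k : exists a : K, v 0 k = a%:A.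
  apply/gr0P; have := gv k; rewrite (_ : _ - _ = 0) //; nia.
have vE : v = \row_k (a k)%:A by apply/rowP => k; rewrite mxE aP.
apply/rowP => k; rewrite aP (next_free (a := a)) ?scale0r ?mxE //.
by rewrite -vE.
Qed.

End Step.

Fixpoint stages (r : nat) : stage r :=
  if r is r'.+1 return stage r then next (stages r') else stage_zero.


(** * Descent of the resolution to the Veronese subalgebra *)

Local Notation B := (veronese R c_gt0).

(** Outside the subalgebra the value is the default 0; the map is applied to entries whose degree is
    a multiple of c. *)
Definition vlift (a : R) : B := insubd (0 : veronese_type R c) a.

Definition vval : {rmorphism B -> R} := val : veronese_type R c -> R.

Lemma vval_inj : injective vval.
Proof. exact: val_inj. Qed.

Lemma grz_vval d (b : B) : grz d b -> grz (c%:Z * d) (vval b).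
Proof.
case: d => d; last by move=> ->; rewrite raddf0; exact: grz0.
by rewrite -PoszM mulnC.
Qed.

Lemma vlift_grz d (a : R) : grz (c%:Z * d) a -> vval (vlift a) = a /\ grz d (vlift a).
Proof.
move=> ga; have av : a \in veronese_pred c.
  case: d ga => d; first by rewrite -PoszM mulnC; exact: gr_veronese.
  case E : (_ * _) => [p|p]; first by nia.
  by move=> ->; exact: rpred0.
have aE : vval (vlift a) = a by rewrite /vlift /vval /= val_insubd av.
split=> //; case: d ga => d; first by rewrite -PoszM mulnC /= /veronese_gr -/(vval _) aE.
case E : (_ * _) => [p|p] a0; first by nia.
by apply: vval_inj; rewrite aE raddf0.
Qed.

Lemma map_vval_inj m p : injective (@map_mx _ _ vval m p).
Proof.
move=> X Y /matrixP XY; apply/matrixP => k l.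
by move: (XY k l); rewrite !mxE => /vval_inj.
Qed.

Let b r := sb (stages r).
Let D r : 'M[R]_(b r.+1, b r) := next_mx (stages r).
Definition vdif r : 'M[B]_(b r.+1, b r) := map_mx vlift (D r).

Lemma vdif_lift r k l :
  vval (vlift (D r k l)) = D r k l /\ grz 1 (vlift (D r k l)).
Proof.
apply: vlift_grz; have := next_fhom (s := stages r) k l.
by rewrite (_ : _ - _ = c%:Z * 1) //; lia.
Qed.

Lemma vdif_val r : map_mx vval (vdif r) = D r.
Proof. by apply/matrixP => k l; rewrite !mxE (vdif_lift k l).1. Qed.

Lemma vdif_hom r : fhom (fun=> r.+1%:Z) (fun=> r%:Z) (vdif r).
Proof.
by move=> k l; rewrite mxE (_ : _ - _ = 1); [exact: (vdif_lift k l).2 | lia].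
Qed.

Lemma fgr_vval r m d (v : 'rV[B]_m) :
  fgr (fun=> r%:Z) d v -> fgr (fun=> (c * r)%:Z) (c%:Z * d) (map_mx vval v).
Proof.
move=> gv k; rewrite mxE PoszM -mulrBr; apply: grz_vval; exact: gv.
Qed.

(** The preimage given by [next_surj] has coordinates of degree c (d - (r + 1)), so they already lie
    in the Veronese subalgebra. *)
Lemma stage_lift r (v : 'rV[B]_(b r)) d :
  sN (s := stages r) (c%:Z * d) (map_mx vval v) ->
  exists w : 'rV_(b r.+1), v = w *m vdif r.
Proof.
move=> /next_surj[w gw wD].
have wl k : vval (vlift (w 0 k)) = w 0 k.
  have /= gk := gw k; apply: (proj1 (@vlift_grz (d - r.+1%:Z) _ _)).
  by move: gk; rewrite PoszM -mulrBr.
exists (map_mx vlift w); apply: map_vval_inj; rewrite map_mxM vdif_val -wD.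
by congr (_ *m _); apply/rowP => k; rewrite !mxE wl.
Qed.

Lemma vdif_complex r : vdif r.+1 *m vdif r = 0.
Proof.
apply: map_vval_inj; rewrite map_mxM !vdif_val map_mx0.
apply/row_matrixP => k; rewrite row_mul row0.
have := next_in (s := stages r.+1) k; rewrite /= /nextN /trunc.
by case: ifP => [_ [_] //|_]; rewrite -/(D r.+1) => ->; rewrite mul0mx.
Qed.

Lemma vdif_exact r (v : 'rV[B]_(b r.+1)) :
  v *m vdif r = 0 <-> exists w : 'rV_(b r.+2), v = w *m vdif r.+1.
Proof.
apply: (fhom_exact (@vdif_hom r) (vdif_complex r)) => d {}v gv v0.
apply: (stage_lift (r := r.+1) (d := d)); apply: next_ker.
  exact: (@fgr_vval r.+1 _ d v gv).
by rewrite -/(D r) -vdif_val -map_mxM v0 map_mx0.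
Qed.

Definition vgen (k : 'I_(b 0)) : residue B := (1 : K).

Lemma vgen_sum (v : 'rV[B]_(b 0)) :
  \sum_k v 0 k *: vgen k = aug (v 0 (ord0 : 'I_1)) :> K.
Proof. by rewrite -[RHS]mulr1; exact: big_ord1. Qed.

(** The kernel of the augmentation consists of the components of degree d >= 1. In R these have
    degree c d >= c, so they belong to the first stage R_(>= c). *)
Lemma vdif_exact0 (v : 'rV[B]_(b 0)) :
  \sum_k v 0 k *: vgen k = 0 <-> exists w : 'rV_(b 1), v = w *m vdif 0.
Proof.
rewrite vgen_sum; split=> [v0|[w ->]]; last first.
  rewrite mxE raddf_sum big1 //= => k _; rewrite rmorphM /=.
  by rewrite (aug_grz (@vdif_hom 0 k 0)) ?mulr0.
have [s vE] := fcomp_sum (fun=> 0 : int) v.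
rewrite vE; apply: (big_ind (fun u : 'rV_(b 0) => exists w : 'rV_(b 1), u = w *m vdif 0)).
- by exists 0; rewrite mul0mx.
- by move=> _ _ [w ->] [u ->]; exists (w + u); rewrite mulmxDl.
move=> d _; set u := fcomp _ d v.
have gu : fgr (fun=> 0%N%:Z) d u by exact: fcomp_gr.
have [d1|d1] := lerP 1 d.
  apply: (stage_lift (r := 0) (d := d)) => /=; rewrite /trunc ifT; last by nia.
  by have := fgr_vval gu; rewrite muln0.
suff -> : u = 0 by exists 0; rewrite mul0mx.
apply/rowP => k; rewrite [in RHS]mxE (ord1 k).
have := gu ord0; have : aug (u 0 (ord0 : 'I_1)) =
    aug (hcomp (grz_grading B) d (v 0 (ord0 : 'I_1))).
  by rewrite mxE subr0.
rewrite subr0; case: (d) d1 => [[|e]|e] // _; rewrite aug_comp0 v0 => u0.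
by move/aug_gr0 => ->; rewrite u0 scale0r.
Qed.

Definition linear_resolution : freeRes (residue B).
Proof.
apply: (@FreeRes _ _ (residue B) b (fun r _ => r%:Z) vdif vgen).
- exact: vdif_hom.
- by move=> k /(_ erefl).
- move=> m; have [a am] := @aug_surj K B m; exists (const_mx a).
  by rewrite vgen_sum mxE.
- exact: vdif_exact0.
- exact: vdif_exact.
Defined.

(** The i-th free module of [linear_resolution] has its whole basis in degree i, so nothing is left
    in degree j after tensoring with K. *)
Lemma koszul_veronese : koszul B.
Proof.
move=> i j ij; exists linear_resolution.
have dK : degK linear_resolution i j = 0.
  apply/matrixP => k l; rewrite !mxE /=; case: eqP => // E.
  by rewrite mul0rn.
rewrite /tor_dim (_ : \rank _ = 0%N) //; apply/eqP; rewrite -leqn0.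
rewrite -(mxrank0 K (rk linear_resolution i) (rk linear_resolution i)) -dK.
case: (i) => [//|i' /=]; exact: mxrankS (capmxSl _ _).
Qed.

End Veronese.

(** * Polynomial rings are Noetherian *)

(** [g i] is a position from [i] on where [t] takes its minimum over all later positions. Iterating
    it past the previous choice gives the subsequence. *)
Lemma nondecreasing_subseq (t : nat -> nat) : exists f : nat -> nat,
  {homo f : i j / (i < j)%N} /\ {homo t \o f : i j / (i <= j)%N}.
Proof.
have /choice[g gP] i : exists j, (i <= j)%N /\ forall k, (i <= k)%N -> (t j <= t k)%N.
  have ex : exists v, `[< exists2 j, (i <= j)%N & t j = v >].
    by exists (t i); apply/asboolP; exists i.
  case: (ex_minnP ex) => v /asboolP[j ij <-] vmin; exists j; split=> // k ik.
  by apply: vmin; apply/asboolP; exists k.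
pose f := fix f m := if m is m'.+1 then g (f m').+1 else g 0%N.
exists f; split.
  apply: homo_ltn => [? ? ?|m]; first exact: ltn_trans.
  by have [] := gP (f m).+1.
apply: homo_leq => [m|? ? ?|m] /=; [exact: leqnn | exact: leq_trans |].
have [lef _] := gP (f m).+1.
suff h k : (f m <= k)%N -> (t (f m) <= t k)%N by apply: h; exact: ltnW.
case: m {lef} => [_|m /= le_k]; first by have [_] := gP 0%N; apply.
have [lef h] := gP (f m).+1; apply: h; exact: leq_trans lef le_k.
Qed.

(* Dickson's lemma *)
Lemma multinom_wqo n (s : nat -> multinom n) : exists i j, (i < j)%N /\ lem (s i) (s j).
Proof.
(* Subsequences are extracted one coordinate at a time: after k rounds the first k exponents are
   nondecreasing. *)
suff /(_ n)[f [f1 f2]] k : exists f : nat -> nat, {homo f : i j / (i < j)%N} /\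
    forall l : 'I_n, (l < k)%N -> {homo (fun i => s (f i) l) : i j / (i <= j)%N}.
  exists (f 0%N), (f 1%N); split; first exact: f1.
  by apply/mnm_lepP => l; exact: f2.
elim: k => [|k [f [f1 f2]]]; first by exists id; split.
have [kn|kn] := ltnP k n; last first.
  by exists f; split=> // l _; apply: f2; exact: leq_trans kn.
have [g [g1 g2]] := nondecreasing_subseq (fun i => s (f i) (Ordinal kn)).
exists (f \o g); split=> [i j ij|l lk i j ij] /=; first by apply/f1/g1.
have [E|lk'] := eqVneq (l : nat) k.
  by rewrite (_ : l = Ordinal kn); [exact: g2 | exact: val_inj].
apply: f2; first by lia.
by move: ij; rewrite leq_eqVlt => /predU1P[->//|/g1/ltnW].
Qed.

(** * Submodules and finite generation *)

Section Span.
Variables (A : comNzRingType) (M : lmodType A).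

Record submodule (L : M -> Prop) : Prop := Submodule {
  submod0 : L 0;
  submodD : forall u v, L u -> L v -> L (u + v);
  submodZ : forall a v, L v -> L (a *: v) }.

Lemma submodB L u v : submodule L -> L u -> L v -> L (u - v).
Proof.
by move=> h Lu Lv; apply: (submodD h) => //; rewrite -scaleN1r; exact: (submodZ h).
Qed.

(** The impredicative form turns membership into an induction principle; [mspanE] recovers
    coefficients. *)
Definition mspan (l : seq M) (v : M) : Prop :=
  forall L, submodule L -> (forall u, u \in l -> L u) -> L v.

Lemma mspan_submodule l : submodule (mspan l).
Proof.
split=> [L h _|u v Lu Lv L h hl|a v Lv L h hl]; first exact: submod0 h.
  by apply: (submodD h); [exact: Lu | exact: Lv].
by apply: (submodZ h); exact: Lv.
Qed.

Lemma mspan_mem l v : v \in l -> mspan l v.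
Proof. by move=> vl L _; apply. Qed.

Lemma mspan_trans l l' v : (forall u, u \in l -> mspan l' u) -> mspan l v -> mspan l' v.
Proof. by move=> h; apply; [exact: mspan_submodule | exact: h]. Qed.

Lemma mspanE l v : mspan l v ->
  exists w : 'I_(size l) -> A, v = \sum_k w k *: l`_k.
Proof.
move/(_ (fun v => exists w : 'I_(size l) -> A, v = \sum_k w k *: l`_k)); apply.
  split; first by exists (fun=> 0); rewrite big1 // => k _; rewrite scale0r.
    move=> _ _ [w ->] [w' ->]; exists (fun k => w k + w' k).
    by rewrite -big_split; apply: eq_bigr => k _; rewrite scalerDl.
  move=> a _ [w ->]; exists (fun k => a * w k).
  by rewrite scaler_sumr; apply: eq_bigr => k _; rewrite scalerA.
move=> u ul; have ui : (index u l < size l)%N by rewrite index_mem.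
exists (fun k => (k == Ordinal ui)%:R).
rewrite (bigD1 (Ordinal ui)) //= eqxx scale1r nth_index // big1 ?addr0 // => k.
by move/negPf => ->; rewrite scale0r.
Qed.

Definition noetherian : Prop := forall L, submodule L ->
  exists2 l : seq M, (forall u, u \in l -> L u) & forall v, L v -> mspan l v.

End Span.

Section Noetherian.
Variables (K : fieldType) (n : nat).
Local Notation S := (mpoly n K).

(** If [L] is not finitely generated, choose v_0, v_1, ... in [L], each outside the span of the
    earlier ones and with least leading monomial. By Dickson's lemma some lead of v_i divides that
    of a later v_j; cancelling the lead of v_j contradicts its minimality. *)
Lemma mpoly_noetherian : noetherian S^o.
Proof.
move=> L hL; apply: contrapT => nfg.
have ex (l : seq S) : exists v : S, (forall u, u \in l -> L u) ->
    [/\ L v, ~ mspan (l : seq S^o) v & forall u : S, L u -> ~ mspan (l : seq S^o) u ->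
       (mlead v <= mlead u)%O].
  (* The value 0 is a default for lists not contained in [L]. *)
  have [lL|] := pselect (forall u, u \in l -> L u); last by exists 0.
  have [v [Lv vl]] : exists v, L v /\ ~ mspan (l : seq S^o) v.
    apply: contrapT => h; apply: nfg; exists l => // v Lv.
    by apply: contrapT => vl; apply: h; exists v.
  elim/(@mleadrect n K): v Lv vl => v IH Lv vl.
  have [[u [Lu ul uv]]|h] := pselect (exists u : S, [/\ L u, ~ mspan (l : seq S^o) u &
    (mlead u < mlead v)%O]); first exact: (IH u).
  exists v => _; split=> // u Lu ul; rewrite leNgt; apply/negP => uv.
  by apply: h; exists u.
have /choice[pick pickP] := ex.
pose lst := fix lst m := if m is m'.+1 then pick (lst m') :: lst m' else [::].
pose v m := pick (lst m).
have lstL m u : u \in lst m -> L u.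
  elim: m u => [|m IH] u //=; rewrite inE => /predU1P[->|]; last exact: IH.
  by have [] := pickP _ IH.
have lst_mem i j : (i < j)%N -> v i \in lst j.
  elim: j => [|j IH] //; rewrite ltnS leq_eqVlt inE => /predU1P[->|/IH ->].
    by rewrite eqxx.
  by rewrite orbT.
have [i [j [ij dvd]]] := multinom_wqo (fun m => mlead (v m)).
have [Lvi vi _] := pickP _ (lstL i); have [Lvj vj vjmin] := pickP _ (lstL j).
rewrite -/(v i) -/(v j) in Lvi vi Lvj vj vjmin.
have nz0 m (u : S) : ~ mspan (lst m : seq S^o) u -> u != 0.
  by move=> h; apply/eqP => u0; apply: h; rewrite u0; exact: submod0 (mspan_submodule _).
have vi0 := nz0 _ _ vi; have vj0 := nz0 _ _ vj.
have ci0 : mcoeff (mlead (v i)) (v i) != 0 by rewrite mleadc_eq0.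
pose d := mnm_sub (mlead (v j)) (mlead (v i)).
have dE : mnm_add d (mlead (v i)) = mlead (v j) by exact: submK.
pose a : K := mcoeff (mlead (v j)) (v j) / mcoeff (mlead (v i)) (v i).
have a0 : a != 0 by rewrite mulf_neq0 ?invr_eq0 ?mleadc_eq0.
pose q : S := a *: mpolyX K d.
have q0 : q != 0.
  apply/eqP => /(congr1 (mcoeff d)) /eqP.
  by rewrite mcoeffZ mcoeffX eqxx mulr1 mcoeff0 (negPf a0).
have qlead : mlead q = d by rewrite mleadZ // mleadXm.
have qv : mlead (q * v i) = mlead (v j) by rewrite mleadM // qlead.
pose u := v j - q * v i.
have Lu : L u by apply: (submodB hL) => //; exact: (submodZ hL q Lvi).
have ul : ~ mspan (lst j : seq S^o) u.
  move=> h; apply: vj; rewrite -(subrK (q * v i) (v j)).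
  apply: (submodD (mspan_submodule _)) => //.
  by apply: (submodZ (mspan_submodule _) q); apply: mspan_mem; exact: lst_mem.
have u0 := nz0 _ _ ul.
have := vjmin u Lu ul; rewrite leNgt => /negP; apply.
(* The lead of [u] is at most that of [v j], since both terms of [u] have this lead. Equality fails
   because the two leading coefficients cancel while [u] is nonzero. *)
rewrite lt_neqAle; apply/andP; split; last first.
  by apply: le_trans (mleadB_le _ _) _; rewrite qv joinxx.
apply/eqP => E; move: u0; rewrite -mleadc_eq0 E mcoeffB.
rewrite -{2}dE -{1}qlead mleadcM qlead mcoeffZ mcoeffX eqxx mulr1.
by rewrite divfK // subrr eqxx.
Qed.

(** Induction on the rank: [l1] generates the ideal of first coordinates, [l2] the vectors of [L]
    with first coordinate 0. Lifts of [l1] together with [l2] generate [L]. *)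
Lemma row_noetherian b : noetherian 'rV[S]_b.
Proof.
elim: b => [|b IH] L hL.
  exists [::] => // v _; rewrite (_ : v = 0); first exact: submod0 (mspan_submodule _).
  by apply/rowP => -[].
have [|l1 l1L l1P] := @mpoly_noetherian (fun a => exists2 v, L v & v 0 0 = a).
  split; first by exists 0; [exact: submod0 hL | rewrite mxE].
    move=> _ _ [u Lu <-] [v Lv <-]; exists (u + v); last by rewrite mxE.
    exact: (submodD hL).
  by move=> a _ [v Lv <-]; exists (a *: v); [exact: (submodZ hL) | rewrite mxE].
have [|l2 l2L l2P] := IH (fun u => L (row_mx (0 : 'rV_1) u)).
  split; first by rewrite row_mx0; exact: submod0 hL.
    by move=> u v Lu Lv; rewrite -[0]addr0 -add_row_mx; exact: (submodD hL).
  by move=> a v Lv; rewrite -[0](scaler0 _ a) -scale_row_mx; exact: (submodZ hL).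
have /choice[f fP] a : exists v : 'rV[S]_b.+1, a \in l1 -> L v /\ v 0 0 = a.
  have [/l1L[v Lv v0]|_] := boolP (a \in l1); first by exists v.
  by exists 0.
pose l := map f l1 ++ map (row_mx (0 : 'rV_1)) l2.
exists l => [u|v Lv].
  by rewrite mem_cat => /orP[/mapP[a /fP[La _] ->]|/mapP[w /l2L Lw ->]].
have [v' [lv' Lv' v0]] : exists v' : 'rV[S]_b.+1, [/\ mspan l v', L v' & v' 0 0 = v 0 0].
  apply: (l1P (v 0 0) _ (fun a => exists v' : 'rV[S]_b.+1,
    [/\ mspan l v', L v' & v' 0 0 = a])); [by exists v | split |].
  - exists 0; split; [exact: submod0 (mspan_submodule _) | exact: submod0 hL |].
    by rewrite mxE.
  - move=> _ _ [u [lu Lu <-]] [w [lw Lw <-]]; exists (u + w); split.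
    + exact: (submodD (mspan_submodule _)).
    + exact: (submodD hL).
    + by rewrite mxE.
  - move=> a _ [u [lu Lu <-]]; exists (a *: u); split; last by rewrite mxE.
      exact: (submodZ (mspan_submodule _)).
    exact: (submodZ hL).
  - move=> a al; have [La <-] := fP a al; exists (f a); split=> //.
    by apply: mspan_mem; rewrite mem_cat map_f.
rewrite -(subrK v' v); apply: (submodD (mspan_submodule _)) => //.
have dE : v - v' = row_mx (0 : 'rV_1) (rsubmx (v - v' : 'rV_(1 + b))).
  suff l0 : lsubmx (v - v' : 'rV_(1 + b)) = 0 by rewrite -l0 hsubmxK.
  apply/rowP => k.
  have k0 : lshift b k = 0 :> 'I_b.+1 by apply: val_inj; rewrite (ord1 k).
  by rewrite 3!mxE k0 v0 subrr mxE.
rewrite dE; apply: (l2P (rsubmx (v - v' : 'rV_(1 + b))) _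
  (fun u => mspan l (row_mx (0 : 'rV_1) u))).
- by rewrite -dE; exact: (submodB hL).
- split; first by rewrite row_mx0; exact: submod0 (mspan_submodule _).
    move=> u w hu hw; rewrite -[0]addr0 -add_row_mx.
    exact: (submodD (mspan_submodule _)).
  move=> a w hw; rewrite -[0](scaler0 _ a) -scale_row_mx.
  exact: (submodZ (mspan_submodule _)).
- by move=> u ul; apply: mspan_mem; rewrite mem_cat map_f ?orbT.
Qed.

End Noetherian.

(** * Koszul homology of a polynomial ring *)

Section Polynomial.
Variables (K : fieldType) (n : nat).
Local Notation S := (polyAlg K n).

(** Koszul complexes take a family indexed by all naturals, hence the padding by 0 from [n] on. *)
Definition varX (k : nat) : S := if insub k is Some i then mpolyX K (mnm1 i) else 0.

Lemma varXE (i : 'I_n) : varX i = mpolyX K (mnm1 i).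
Proof. by rewrite /varX valK. Qed.

Lemma varX_gr k : gr 1 (varX k).
Proof.
rewrite /varX; case: insubP => [i _ _|_]; last exact: grading0 (gr_grading S) 1%N.
by rewrite /= /mpoly_gr dhomogX /= mdeg1.
Qed.

(** Each monomial is assigned to one of the first m variables dividing it. *)
Lemma varX_span m j (y : S) : (m <= n)%N -> grz j y ->
  (forall e, e \in msupp y -> exists2 i : 'I_n, (i < m)%N & e i != 0%N) ->
  exists2 u : nat -> S, (forall k, grz (j - 1) (u k)) &
    y = \sum_(k < m) varX k * u k.
Proof.
move=> mn; case: j => [d gy ye|d -> _]; last first.
  exists (fun=> 0); first by move=> k; exact: grz0.
  by rewrite big1 // => k _; rewrite mulr0.
rewrite [y]mpolyE big_seq.
apply: (big_ind (fun z : S => exists2 u : nat -> S,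
   (forall k, grz (d%:Z - 1) (u k)) & z = \sum_(k < m) varX k * u k)).
- exists (fun=> 0); first by move=> k; exact: grz0.
  by rewrite big1 // => k _; rewrite mulr0.
- move=> _ _ [u hu ->] [w hw ->]; exists (fun k => u k + w k).
    by move=> k; exact: (gradingD (grz_grading S)).
  by rewrite -big_split; apply: eq_bigr => k _; rewrite mulrDr.
move=> e es; have [i im ei] := ye e es.
have de : mdeg e = d by exact: (dhomog_mf gy).
have le_e : lem (mnm1 i) e by rewrite lep1mP.
pose t : S := mcoeff e y *: mpolyX K (mnm_sub e (mnm1 i)).
exists (fun k : nat => if k == i :> nat then t else 0).
  move=> k; case: ifP => _; last exact: grz0.
  have d1 : d = (mdeg (mnm_sub e (mnm1 i)) + 1)%N by rewrite -(mdeg1 i) -mdegD submK.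
  rewrite (_ : _ - 1 = (mdeg (mnm_sub e (mnm1 i)))%:Z); last by lia.
  by apply: grZ; rewrite /= /mpoly_gr dhomogX.
rewrite (bigD1 (Ordinal im)) //= eqxx big1 ?addr0; last first.
  move=> k; rewrite -val_eqE /= => /negPf ->; exact: mulr0.
by rewrite varXE -scalerAr -mpolyXD addmC submK.
Qed.

Lemma varX_mul_supp (i : 'I_n) (u : S) e : mcoeff e (varX i * u) != 0 -> e i != 0%N.
Proof.
rewrite varXE mulrC -mcoeff_msupp (perm_mem (msuppMX _ _)) => /mapP[e' _ ->].
by rewrite mnmDE mnm1E eqxx.
Qed.

(** The variables form a regular sequence. A monomial of y times x_m occurs in some x_k u_k with k <
    m, so x_k divides it; as k differs from m, x_k divides the monomial of y. *)
Lemma varX_regular m j (y : S) (mn : (m < n)%N) (u : nat -> S) : grz j y ->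
  varX m * y = \sum_(k < m) varX k * u k ->
  exists2 u : nat -> S, (forall k, grz (j - 1) (u k)) &
    y = \sum_(k < m) varX k * u k.
Proof.
move=> gy yE; apply: varX_span => //; first exact: ltnW.
move=> e; rewrite mcoeff_msupp => ey; apply: contrapT => h.
pose i := Ordinal mn; have := mcoeffMX y (mnm1 i) e.
rewrite -varXE mulrC [varX i * y]yE raddf_sum big1.
  by move=> /esym/eqP; rewrite (negPf ey).
move=> k _; apply/eqP; apply: contrapT => /negP ek; apply: h.
have kn : (k < n)%N := ltn_trans (ltn_ord k) mn.
exists (Ordinal kn); first exact: (ltn_ord k).
have := @varX_mul_supp (Ordinal kn) _ _ ek.
by rewrite mnmDE mnm1E -val_eqE /= (gtn_eqF (ltn_ord k)).
Qed.

(** Induction along the mapping cone. In a cycle (f, g) the part g is a boundary: by induction in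
    positive exterior degree, by [varX_regular] in degree 0, where x_m g = - d f. If d g' = g, then
    f + x_m g' is a cycle of the smaller complex, bounded by some h, and (h, -g') bounds (f, g). *)
Lemma polyAlg_acyclic m i j : (m <= n)%N ->
  kz_acyclic (xmul varX) (@grz _ S) m i.+1 j.
Proof.
have GS := grz_sub varX_gr.
elim: m i j => [|m IH] i j mn; first exact: kz_acyclic_big.
move=> [f g] /= [fi gi] [df dg].
have {}dg : kz_d (xmul varX) g = 0 by apply/eqP; rewrite -oppr_eq0 dg.
have [g' [g'i g'E]] : exists g', kz_in (@grz _ S) i.+1 (j - 1) g' /\
    kz_d (xmul varX) g' = g.
  case: i fi gi => [|i] fi gi; last by apply: IH => //; exact: ltnW.
  have [y yj gE] := kz_in0P gi; rewrite gE.
  apply/(kz_boundP _ _ _ GS).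
  have /(kz_boundP _ _ _ GS)[u uj uE] : exists f', kz_in (@grz _ S) 1 j f' /\
      kz_d (xmul varX) f' = kz_emb m (varX m * y).
    exists (- f); split; first exact: (kz_inN GS).
    rewrite raddfN; apply/eqP; rewrite eqr_oppLR; apply/eqP.
    have -> : kz_emb m (varX m * y) = kz_map (xmul varX m) g.
      by rewrite gE kz_map_emb.
    by apply/eqP; rewrite -addr_eq0 df.
  exact: varX_regular uE.
have [||h [hi hE]] := IH i j (ltnW mn) (f + kz_map (xmul varX m) g').
- apply: (kz_inD GS) => //; rewrite -[j](subrK 1).
  by apply: kz_in_map g'i => d a; exact: (gsubX GS).
- rewrite raddfD; apply: etrans df; congr (_ + _).
  rewrite -g'E; apply: kz_d_map => k a; exact: (@xmulC _ _ varX).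
exists (h, - g'); split=> /=.
  by split=> //; exact: (kz_inN GS).
rewrite hE; congr (_, _); last by rewrite raddfN /= g'E opprK.
by rewrite (raddfN (@kz_map _ _ (xmul varX m) m)) addrK.
Qed.

(** H_0 is K in degree 0, as every nonconstant monomial is divisible by a variable. *)
Lemma polyAlg_acyclic0 j : j != 0 -> kz_acyclic (xmul varX) (@grz _ S) n 0 j.
Proof.
move=> j0; apply/(kz_acyclic0P _ _ (grz_sub varX_gr)) => y gy.
apply: varX_span => // e ey; case: j j0 gy => [d|d] d0 gy; last first.
  by move: ey; rewrite gy msupp0.
have de : mdeg e = d by exact: (dhomog_mf gy).
apply: contrapT => h; move: d0; rewrite -de => /eqP; apply; congr Posz.
apply/eqP; rewrite mdeg_eq0; apply/eqP/mnmP => i; rewrite mnm0E.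
by apply/eqP; apply: contrapT => /negP ei; apply: h; exists i.
Qed.

End Polynomial.

(** * Minimal resolutions over a polynomial ring *)

Section Resolution.
Variables (K : fieldType) (n : nat).
Local Notation S := (polyAlg K n).

(** The homogeneous components of a finite generating set are again finitely many generators. *)
Lemma graded_gens b (deg : 'I_b -> int) (L : 'rV[S]_b -> Prop) : submodule L ->
  (forall d v, L v -> L (fcomp deg d v)) ->
  exists m (G : 'I_m -> 'rV[S]_b), (forall k, exists2 d, fgr deg d (G k) & L (G k)) /\
    forall v, L v <->
      exists2 w : 'I_m -> S, (forall k : 'I_m, True) & v = \sum_k w k *: G k.
Proof.
move=> hL Lc; have [l lL lP] := row_noetherian hL.
have /choice[f fP] := @fcomp_sum K S b deg.
pose l' := [seq fcomp deg d v | v <- l, d <- f v].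
have l'P k : (k < size l')%N -> exists2 d, fgr deg d l'`_k & L l'`_k.
  move=> /(mem_nth 0)/allpairsPdep[v [d [vl _ ->]]]; exists d.
    exact: fcomp_gr.
  by apply: Lc; exact: lL.
exists (size l'), (fun k => l'`_k); split=> [k|v]; first exact: l'P.
split=> [/lP lv|[w _ ->]].
  have [|w ->] := @mspanE S 'rV[S]_b l' v _; last by exists w.
  apply: (mspan_trans _ lv) => u ul; rewrite [u]fP.
  have sub := @mspan_submodule S 'rV[S]_b l'.
  rewrite big_seq; apply: (big_ind (mspan l')); first exact: submod0 sub.
    by move=> ? ?; exact: (submodD sub).
  move=> d df; apply: mspan_mem; apply/allpairsPdep; by exists u, d.
apply: (big_ind L); first exact: submod0 hL.
  by move=> ? ?; exact: (submodD hL).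
by move=> k _; apply: (submodZ hL); have [] := l'P k (ltn_ord k).
Qed.

(* rL_min says that the free module is a minimal cover of its quotient by rL. *)
Record rstage := RStage {
  rb : nat;
  rdeg : 'I_rb -> int;
  rL : 'rV[S]_rb -> Prop;
  rL_sub : submodule rL;
  rL_comp : forall d v, rL v -> rL (fcomp rdeg d v);
  rL_min : forall d v k, fgr rdeg d v -> rL v -> aug (v 0 k) = 0 }.

Section Step.
Variable s : rstage.

Lemma rstage_gens : exists m (e : ('I_m -> int) * 'M[S]_(m, rb s)),
  [/\ fhom e.1 (rdeg (r := s)) e.2,
      forall v, rL v <-> exists w : 'rV_m, v = w *m e.2,
      forall k l, aug (e.2 k l) = 0 &
      forall (w : 'rV[S]_m) k a, w *m e.2 = 0 -> a * w 0 k <> 1].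
Proof.
have [||m [G [GQ GL Gmin]]] := @exists_minimal_gens S 'rV[S]_(rb s) (fun=> True)
  (fun v => exists2 d, fgr (rdeg (r := s)) d v & rL v) _ _ _
  (graded_gens (rL_sub s) (@rL_comp s)) => //.
have /fin_all_exists[e eP] k : exists d, fgr (rdeg (r := s)) d (G k) /\ rL (G k).
  by have [d] := GQ k; exists d.
pose D : 'M[S]_(m, rb s) := \matrix_k G k.
have DE (w : 'rV[S]_m) : w *m D = \sum_k w 0 k *: G k.
  by rewrite mulmx_sum_row; apply: eq_bigr => k _; rewrite rowK.
exists m, (e, D); split=> /=.
- by move=> k l; rewrite mxE; exact: (eP k).1.
- move=> v; split=> [/GL[w _ ->]|[w ->]].
    exists (\row_k w k); rewrite DE; apply: eq_bigr => k _; by rewrite mxE.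
  by rewrite DE; apply/GL; exists (fun k => w 0 k).
- by move=> k l; rewrite mxE; have [gk Lk] := eP k; exact: rL_min gk Lk.
- move=> w k a; rewrite DE => w0; exact: (Gmin _ (fun=> I) w0 k a I).
Qed.

Definition rnext_dim : nat := sval (cid rstage_gens).
Definition rnext_deg : 'I_rnext_dim -> int := (sval (cid (svalP (cid rstage_gens)))).1.
Definition rnext_mx : 'M[S]_(rnext_dim, rb s) :=
  (sval (cid (svalP (cid rstage_gens)))).2.

Lemma rnextP : [/\ fhom rnext_deg (rdeg (r := s)) rnext_mx,
      forall v, rL v <-> exists w : 'rV_rnext_dim, v = w *m rnext_mx,
      forall k l, aug (rnext_mx k l) = 0 &
      forall (w : 'rV[S]_rnext_dim) k a, w *m rnext_mx = 0 -> a * w 0 k <> 1].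
Proof. exact: svalP (cid (svalP (cid rstage_gens))). Qed.

Lemma rnext_sub : submodule (fun w : 'rV[S]_rnext_dim => w *m rnext_mx = 0).
Proof.
split; first exact: mul0mx.
- by move=> u v u0 v0; rewrite mulmxDl u0 v0 addr0.
- by move=> a v v0; rewrite -scalemxAl v0 scaler0.
Qed.

Lemma rnext_comp d (w : 'rV[S]_rnext_dim) :
  w *m rnext_mx = 0 -> fcomp rnext_deg d w *m rnext_mx = 0.
Proof. by have [h _ _ _] := rnextP; rewrite -(fcomp_mul _ _ h) => ->; exact: fcomp0. Qed.

(** A coordinate of nonzero degree has augmentation 0. One of degree 0 is a scalar, and if nonzero
    it would be a unit in a relation between minimal generators. *)
Lemma rnext_min d (w : 'rV[S]_rnext_dim) k :
  fgr rnext_deg d w -> w *m rnext_mx = 0 -> aug (w 0 k) = 0.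
Proof.
move=> gw w0; have [_ _ _ /(_ w k _ w0) h] := rnextP; have gk := gw k.
have [/eqP|/eqP dk] := eqVneq (d - rnext_deg k) 0; last exact: aug_grz dk.
move/eqP => dk; rewrite dk in gk; have wE := aug_gr0 (gk : gr 0 _).
apply/eqP; apply: contrapT => /negP a0; apply: (h (aug (w 0 k))^-1%:A).
by rewrite {2}wE -scalerAl mul1r scalerA mulVf // scale1r.
Qed.

Definition rnext : rstage := RStage rnext_sub rnext_comp rnext_min.

End Step.

Section Quotient.
Variables (R : stdGradedAlg K) (phi : gradedSurj S R).

Definition rzero_L (v : 'rV[S]_1) : Prop := phi (v 0 0) = 0.

Lemma phi_grz d a : grz d a -> grz d (phi a).
Proof. by case: d => d; [exact: gsurj_gr | move=> ->; exact: raddf0]. Qed.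

Lemma phi_comp d a : phi (hcomp (grz_grading S) d a) = hcomp (grz_grading R) d (phi a).
Proof.
rewrite [in RHS](compE (grz_grading S) a) raddf_sum comp_sum.
rewrite {1}[a](compE (grz_grading S)) comp_sum raddf_sum; apply: eq_bigr => e _ /=.
have ge := comp_gr (grz_grading S) e a.
rewrite (comp_homog _ _ ge) (comp_homog _ _ (phi_grz ge)).
by case: ifP => // _; rewrite raddf0.
Qed.

Lemma rzero_sub : submodule rzero_L.
Proof.
split; rewrite /rzero_L; first by rewrite mxE raddf0.
- by move=> u v u0 v0; rewrite mxE rmorphD /= u0 v0 addr0.
- by move=> a v v0; rewrite mxE rmorphM /= v0 mulr0.
Qed.

Lemma rzero_comp d v : rzero_L v -> rzero_L (fcomp (fun=> 0) d v).
Proof. by rewrite /rzero_L mxE phi_comp => ->; exact: comp0. Qed.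

Lemma rzero_min d v k : fgr (fun=> 0) d v -> rzero_L v -> aug (v 0 k) = 0.
Proof.
rewrite /rzero_L (ord1 k) => /(_ 0); rewrite subr0 => gv v0.
have [/eqP|/eqP d0] := eqVneq d 0; last exact: aug_grz d0.
move/eqP => d0; rewrite d0 in gv; have vE := aug_gr0 (gv : gr 0 _).
apply: (@scale1_inj _ R); rewrite scale0r -v0 [in RHS]vE.
by rewrite linearZ rmorph1.
Qed.

Definition rzero : rstage := RStage rzero_sub rzero_comp rzero_min.

Fixpoint syzygies (i : nat) : rstage := if i is i'.+1 then rnext (syzygies i') else rzero.

Let b i := rb (syzygies i).
Let dg i : 'I_(b i) -> int := rdeg (r := syzygies i).
Let D i : 'M[S]_(b i.+1, b i) := rnext_mx (syzygies i).

Definition qgen (k : 'I_(b 0)) : quotient_module phi := (1 : R).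

Lemma qgen_sum (v : 'rV[S]_(b 0)) :
  \sum_k v 0 k *: qgen k = phi (v 0 (ord0 : 'I_1)) :> R.
Proof. by rewrite -[RHS]mulr1; exact: big_ord1. Qed.

Definition minimal_resolution : freeRes (quotient_module phi).
Proof.
apply: (@FreeRes _ _ (quotient_module phi) b dg D qgen).
- by move=> i; have [] := rnextP (syzygies i).
- by move=> k; exact: gr1.
- move=> m; have [a am] := gsurj_surj phi m; exists (const_mx a).
  by rewrite qgen_sum mxE.
- by move=> v; rewrite qgen_sum; have [_ h _ _] := rnextP (syzygies 0); exact: h.
- by move=> i v; have [_ h _ _] := rnextP (syzygies i.+1); exact: h.
Defined.

(** By minimality all differentials vanish after tensoring with K, so each basis element gives a
    nonzero class in Tor. Bounds on t_i thus become bounds on basis degrees. *)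
Lemma minimal_resolution_tor i (k : 'I_(b i)) :
  tor_dim minimal_resolution i (dg k) <> 0%N.
Proof.
have dK0 t : difK minimal_resolution t = 0.
  by apply/matrixP => u v; rewrite !mxE; have [_ _ + _] := rnextP (syzygies t); apply.
rewrite /tor_dim /boundariesK dK0 mulmx0 mxrank0 subn0.
have degK0 : degK minimal_resolution i (dg k) != 0.
  apply/eqP => /matrixP/(_ k k); rewrite !mxE !eqxx mulr1n => /eqP.
  by rewrite oner_eq0.
have sub : (degK minimal_resolution i (dg k) <= cyclesK minimal_resolution i (dg k))%MS.
  case: i k degK0 => [|i] k _; first exact: submx_refl.
  by rewrite /cyclesK sub_capmx submx_refl sub_kermx dK0 mulmx0 eqxx.
have := mxrankS sub; move: degK0; rewrite -mxrank_eq0 => /eqP d0 /[swap] c0.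
by rewrite c0 leqn0 => /eqP.
Qed.

(** * Vanishing of Koszul homology by dimension shifting *)

Let x := varX K n.
Let y k : R := phi (x k).

Definition syzygy_gr i (d : int) (v : 'rV[S]_(b i)) :=
  fgr (@dg i) d v /\ rL (r := syzygies i) v.

Definition mulDi i : {additive 'rV[S]_(b i.+1) -> 'rV[S]_(b i)} := mulmxr (D i).

Definition eval0 (v : 'rV[S]_(b 0)) : R := phi (v 0 (ord0 : 'I_1)).
Lemma eval0_is_additive : zmod_morphism eval0.
Proof. by move=> u v; rewrite /eval0 !mxE raddfB. Qed.
HB.instance Definition _ :=
  GRing.isZmodMorphism.Build 'rV[S]_(b 0) R eval0 eval0_is_additive.

Lemma free_acyclic i t j :
  kz_acyclic (xscale x 'rV[S]_(b i)) (fgr (@dg i)) n t.+1 j.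
Proof. by apply: fgr_acyclic => [|k]; [exact: varX_gr | exact: polyAlg_acyclic]. Qed.

Lemma free_acyclic0 i j : (forall k, dg (i := i) k < j) ->
  kz_acyclic (xscale x 'rV[S]_(b i)) (fgr (@dg i)) n 0 j.
Proof.
move=> h; apply: fgr_acyclic => [|k]; first exact: varX_gr.
by apply: polyAlg_acyclic0; rewrite subr_eq0 gt_eqF.
Qed.

Lemma syzygy_gr_sub i : gsub (xscale x 'rV[S]_(b i)) (@syzygy_gr i).
Proof.
have GF := fgr_sub (@varX_gr K n) (@dg i); have GL := rL_sub (syzygies i).
split=> [d|d u v [gu Lu] [gv Lv]|d k v [gv Lv]]; split.
- exact: gsub0 GF d.
- exact: submod0 GL.
- exact: (gsubB GF).
- exact: (submodB GL).
- exact: (gsubX GF).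
- exact: (submodZ GL).
Qed.

Lemma mulDi_syzygy_gr i d v : fgr (@dg i.+1) d v -> syzygy_gr d (mulDi i v).
Proof.
have [h1 h2 _ _] := rnextP (syzygies i).
by move=> gv; split; [exact: fgr_mul gv | apply/h2; exists v].
Qed.

Lemma mulDi_surj i d v : syzygy_gr d v -> exists2 w, fgr (@dg i.+1) d w & mulDi i w = v.
Proof.
have [h1 h2 _ _] := rnextP (syzygies i).
move=> [gv /h2[w vE]]; exists (fcomp (@dg i.+1) d w); first exact: fcomp_gr.
rewrite /= -(fcomp_mul _ _ h1) -vE; apply/rowP => k; rewrite mxE.
by rewrite (comp_homog _ _ (gv k)) eqxx.
Qed.

Lemma mulDi_x i k v :
  mulDi i (xscale x 'rV[S]_(b i.+1) k v) = xscale x 'rV[S]_(b i) k (mulDi i v).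
Proof. by rewrite /= -scalemxAl. Qed.

(** Free modules have no higher Koszul homology, so H_t of the i-th syzygy module is governed by
    H_(t-1) of the next one, down to H_0 of the (i+t)-th. That one is covered by a free module with
    basis in degrees below j. *)
Lemma syzygy_gr_acyclic t i j : (forall k, dg (i := (i + t).+1) k < j) ->
  kz_acyclic (xscale x 'rV[S]_(b i)) (@syzygy_gr i) n t j.
Proof.
elim: t i => [|t IH] i.
  have GF := fgr_sub (@varX_gr K n) (@dg i.+1).
  rewrite addn0 => h.
  exact: (kz_acyclic0_surj (@mulDi_x i) GF (@syzygy_gr_sub i) (@mulDi_syzygy_gr i)
           (@mulDi_surj i) (free_acyclic0 h)).
move=> h; apply: (kz_acyclic_coker (@xscaleC _ _ x _) (@mulDi_x i)
  (fgr_sub (@varX_gr K n) (@dg i.+1)) (@mulDi_syzygy_gr i) (@mulDi_surj i)).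
  exact: free_acyclic.
by apply: (IH i.+1); rewrite addSnnS.
Qed.

Lemma quotient_acyclic i j : (forall k : 'I_(b i), dg k < j) ->
  kz_acyclic (xmul y) (@grz _ R) n i j.
Proof.
have GF := fgr_sub (@varX_gr K n) (@dg 0).
have GR : gsub (xmul y) (@grz _ R).
  by apply: grz_sub => k; apply: gsurj_gr; exact: varX_gr.
have ex k v : eval0 (xscale x 'rV[S]_(b 0) k v) = xmul y k (eval0 v).
  by rewrite /eval0 /= mxE rmorphM.
have eF d v : fgr (@dg 0) d v -> grz d (eval0 v).
  by move=> /(_ (ord0 : 'I_1)); rewrite subr0; exact: phi_grz.
have eS d m : grz d m -> exists2 v, fgr (@dg 0) d v & eval0 v = m.
  move=> gm; have [a am] := gsurj_surj phi m.
  exists (fcomp (@dg 0) d (const_mx a)); first exact: fcomp_gr.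
  by rewrite /eval0 !mxE phi_comp subr0 am (comp_homog _ _ gm) eqxx.
case: i => [|i] h.
  exact: (kz_acyclic0_surj ex GF GR eF eS (free_acyclic0 h)).
apply: (kz_acyclic_coker (@xscaleC _ _ x _) ex GF eF eS).
  exact: free_acyclic.
(* The graded kernel of [eval0] is by definition the syzygy module of index 0. *)
exact: (@syzygy_gr_acyclic i 0).
Qed.

End Quotient.
End Resolution.

(** * Presentations *)

Section Presentation.
Variables (K : fieldType) (R : stdGradedAlg K) (g : seq R).
Hypothesis gg : forall x, x \in g -> gr 1 x.
Hypothesis gP : forall x, gr 1 x -> exists a : R -> K, x = \sum_(y <- g) a y *: y.
Local Notation S := (polyAlg K (size g)).

Definition pres (p : S) : R := mmap (in_alg R) (fun i => g`_i) p.

Lemma pres_is_additive : zmod_morphism pres.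
Proof. exact: raddfB. Qed.
HB.instance Definition _ := GRing.isZmodMorphism.Build S R pres pres_is_additive.

Lemma pres_is_multiplicative : monoid_morphism pres.
Proof. by split; [exact: rmorph1 | exact: rmorphM]. Qed.
HB.instance Definition _ := GRing.isMonoidMorphism.Build S R pres pres_is_multiplicative.

Lemma pres_is_scalable : scalable pres.
Proof. by move=> a p; rewrite /pres mmapZ /= mulr_algl. Qed.
HB.instance Definition _ := GRing.isScalable.Build K S R _ pres pres_is_scalable.

Lemma pres_gr i (p : S) : gr i p -> gr i (pres p).
Proof.
move=> gp; rewrite /pres /mmap.
apply: (grading_sum (gr_grading R)) => m ms.
rewrite mulr_algl; apply: grZ.
rewrite -(dhomog_mf gp ms) /= mdegE /mmap1.
apply: (big_rec2 (fun (d : nat) (a : R) => gr d a)); first exact: gr1.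
move=> k d a _ ga; apply: grM => //.
elim: (m k) => [|e IH]; first exact: gr1.
by rewrite exprS -add1n; apply: grM => //; apply: gg; exact: mem_nth.
Qed.

(** Induction on the degree, as R_(d+1) is spanned by products of R_1 and R_d, and R_1 by [g]. *)
Lemma pres_surj y : exists p, pres p = y.
Proof.
suff H d z : gr d z -> exists p, pres p = z.
  rewrite [y](compE (gr_grading R)).
  apply: (big_ind (fun z => exists p, pres p = z)); first by exists 0; exact: raddf0.
    by move=> _ _ [p <-] [q <-]; exists (p + q); exact: raddfD.
  by move=> d _; apply: (H d); exact: comp_gr.
elim: d z => [|d IH] z.
  by move=> /gr0P[k ->]; exists k%:A; rewrite linearZ rmorph1.
rewrite -add1n => /grM_gen[s hs ->]; rewrite big_seq.
apply: (big_ind (fun z => exists p, pres p = z)); first by exists 0; exact: raddf0.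
  by move=> _ _ [p <-] [q <-]; exists (p + q); exact: raddfD.
move=> t /hs[/gP[a ->] /IH[q <-]].
suff [p <-] : exists p, pres p = \sum_(y <- g) a y *: y.
  by exists (p * q); exact: rmorphM.
rewrite big_seq; apply: (big_ind (fun z => exists p, pres p = z)).
- by exists 0; exact: raddf0.
- by move=> _ _ [p <-] [p' <-]; exists (p + p'); exact: raddfD.
move=> u ug; have ui : (index u g < size g)%N by rewrite index_mem.
exists (a u *: mpolyX K (mnm1 (Ordinal ui))); rewrite linearZ; congr (_ *: _).
by rewrite /= /pres mmapX mmap1U /= nth_index.
Qed.

Definition presentation : gradedSurj S R := GradedSurj pres_gr pres_surj.

End Presentation.

(** * From bounds on basis degrees to Koszulness *)

Local Open Scope classical_set_scope.
Local Open Scope ring_scope.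

Theorem theorem3p4 (K : fieldType) (R : stdGradedAlg K) :
  (exists c0 : nat, forall (c : nat) (c_gt0 : (0 < c)%N),
     (c0 <= c)%N -> koszul (veronese R c_gt0)) /\
  (forall (n : nat) (I : polyAlg K n -> Prop) (phi : gradedSurj (polyAlg K n) R),
     homogeneous_ideal I -> (forall p, phi p = 0 <-> I p) ->
     forall (c : nat) (c_gt0 : (0 < c)%N),
       (ereal_sup [set tsup (quotient_module phi) i * ((1 + i)%:R^-1)%:E
                     | i in [set: nat]] <= (c%:R)%:E)%E ->
       koszul (veronese R c_gt0)).
Proof.
split.
  have [g gg gP] := gr1_fin R; pose phi := presentation gg gP.
  pose dg i (k : 'I_(rb (syzygies phi i))) := rdeg k.
  (* A crude bound for all basis degrees in homological positions up to the number of variables;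
     beyond that H_i vanishes. *)
  exists (\sum_(i < (size g).+1) \sum_k `|dg i k|)%N => c c_gt0 c0.
  have gx k : gr 1 (phi (varX K (size g) k)) by apply: gsurj_gr; exact: varX_gr.
  apply: (@koszul_veronese K R c c_gt0 (size g)
    (fun k => phi (varX K (size g) k)) gx) => i j cj.
  have [gi|ig] := ltnP (size g) i.
    by apply: kz_acyclic_big => //; exact: grz_sub.
  apply: quotient_acyclic => k.
  have le_c : (`|dg i k| <= c)%N.
    apply: leq_trans c0; rewrite (bigD1 (Ordinal (ig : (i < (size g).+1)%N))) //=.
    by rewrite (bigD1 k) //= -addnA leq_addr.
  have : (c <= c * i.+1)%N by rewrite leq_pmulr.
  by rewrite -/(dg i k); lia.
move=> n I phi _ _ c c_gt0 hc.
have gx k : gr 1 (phi (varX K n k)) by apply: gsurj_gr; exact: varX_gr.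
apply: (@koszul_veronese K R c c_gt0 n (fun k => phi (varX K n k)) gx) => i j cj.
apply: quotient_acyclic => k; apply: le_lt_trans cj.
set d : int := rdeg k.
have i0 : 0 < (1 + i)%:R :> Rdefinitions.R by rewrite ltr0n.
(* The basis degree [d] carries a nonzero Betti number, so it is at most t_i, and the hypothesis on
   c bounds d / (1 + i). *)
have : ((d%:~R * (1 + i)%:R^-1 : Rdefinitions.R)%:E <= (c%:R)%:E)%E.
  apply: le_trans hc; apply: le_trans (ereal_sup_ubound _); last by exists i.
  rewrite EFinM lee_pmul2r // ?lte_fin ?invr_gt0 //.
  apply: ereal_sup_ubound; exists d => //=.
  exists (tor_dim (minimal_resolution phi) i d); first exact: minimal_resolution_tor.
  by exists (minimal_resolution phi).
rewrite lee_fin ler_pdivrMr // -natrM -[X in _ <= X]/((c * (1 + i))%:Z%:~R).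
by rewrite ler_int.
Qed.
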